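(* The hyperelliptic Torelli group $\mathcal{ST}(n)\le\mathrm{Out}(F_n)$ is generated by the set of (outer automorphism classes of) doubled commutator transvections.
   Context: $F_n$ is the free group with preferred basis $X=\{x_1,\dots,x_n\}$, and $\iota\in\mathrm{Aut}(F_n)$ is the automorphism inverting each $x_i$. For $\theta\in\mathrm{Aut}(F_n)$, $[\theta]$ denotes its class in $\mathrm{Out}(F_n)$. An element $[\theta]\in\mathrm{Out}(F_n)$ is hyperelliptic if it commutes with $[\iota]$ in $\mathrm{Out}(F_n)$; then $\theta(X)$ is called a hyperelliptic basis of $F_n$. $\mathrm{HOut}(F_n)$ denotes the centralizer of $[\iota]$ in $\mathrm{Out}(F_n)$, $\mathcal{I}_n$ is the Torelli group, i.e. the kernel of $\mathrm{Out}(F_n)\to\mathrm{GL}_n(\mathbb{Z})$, and $\mathcal{ST}(n)=\mathrm{HOut}(F_n)\cap\mathcal{I}_n$. With $[g,h]=ghg^{-1}h^{-1}$, a doubled commutator transvection is an automorphism of $F_n$ that, for some hyperelliptic basis $Y$ and some pairwise distinct $a,b,c\in Y$, maps $c\mapsto[a,b]\cdot c\cdot[b^{-1},a^{-1}]$ and fixes all other elements of $Y$. *)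

(* Defs.v *)
From HB Require Import structures.
From mathcomp Require Import all_boot all_algebra.
From mathcomp Require Import boolp classical_sets.

Set Implicit Arguments.
Unset Strict Implicit.
Unset Printing Implicit Defensive.

Import GRing.Theory.

Local Open Scope quotient_scope.
Local Open Scope classical_set_scope.
Local Open Scope group_scope.

Definition subgroup (G : groupType) (H : set G) : Prop :=
  H 1 /\ forall x y, H x -> H y -> H (x / y).

Definition generated (G : groupType) (S : set G) : set G :=
  smallest (@subgroup G) S.

Definition centralizer (G : groupType) (x : G) : set G :=
  [set y | commute y x].

Definition kernel (G H : groupType) (f : G -> H) : set G :=
  [set x | f x = 1].

(* MathComp's [~ g, h] is g^-1 h^-1 g h. *)
Definition commutator (G : groupType) (g h : G) : G := g * h * g^-1 * h^-1.

(* The product of automorphisms is composition, (f * g) x = f (g x).  The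
   inverse function is stored, but f alone determines the record (autP). *)

Record aut (G : groupType) := Aut {
  aut_fun :> G -> G;
  aut_inv : G -> G;
  aut_morph : {morph aut_fun : x y / x * y};
  aut_funK : cancel aut_fun aut_inv;
  aut_invK : cancel aut_inv aut_fun }.

HB.instance Definition _ (G : groupType) := gen_eqMixin (aut G).
HB.instance Definition _ (G : groupType) := gen_choiceMixin (aut G).
HB.instance Definition _ (G : groupType) (f : aut G) :=
  isMultiplicative.Build G G (aut_fun f) (aut_morph f).

Section AutGroup.
Variable G : groupType.
Implicit Types (f g h : aut G) (x y : G).

Lemma autP f g : f =1 g -> f = g.
Proof.
case: f g => [f f' fM fK f'K] [g g' gM gK g'K] /= fg.
have {}fg : f = g by apply/funext.
case: _ / fg in gM gK g'K *.
have fg' : f' = g' by apply/funext => x; rewrite -{1}(g'K x) fK.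
case: _ / fg' in gK g'K *.
by congr Aut; apply: Prop_irrelevance.
Qed.

Fact aut1_morph : {morph @id G : x y / x * y}. Proof. by []. Qed.
Definition aut1 : aut G := @Aut G id id aut1_morph (fun=> erefl) (fun=> erefl).

Fact aut_mul_morph f g : {morph f \o g : x y / x * y}.
Proof. by move=> x y; rewrite /= !aut_morph. Qed.
Fact aut_mul_funK f g : cancel (f \o g) (aut_inv g \o aut_inv f).
Proof. by move=> x; rewrite /= !aut_funK. Qed.
Fact aut_mul_invK f g : cancel (aut_inv g \o aut_inv f) (f \o g).
Proof. by move=> x; rewrite /= !aut_invK. Qed.
Definition aut_mul f g : aut G :=
  Aut (@aut_mul_morph f g) (@aut_mul_funK f g) (@aut_mul_invK f g).

Fact aut_V_morph f : {morph aut_inv f : x y / x * y}.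
Proof. by move=> x y; rewrite -{1}(aut_invK f x) -{1}(aut_invK f y) -aut_morph aut_funK. Qed.
Definition aut_V f : aut G := Aut (@aut_V_morph f) (@aut_invK _ f) (@aut_funK _ f).

Fact aut_mulA : associative aut_mul. Proof. by move=> f g h; apply: autP. Qed.
Fact aut_mul1 : left_id aut1 aut_mul. Proof. by move=> f; apply: autP. Qed.
Fact aut_1mul : right_id aut1 aut_mul. Proof. by move=> f; apply: autP. Qed.
Fact aut_mulV : left_inverse aut1 aut_V aut_mul.
Proof. by move=> f; apply: autP => x /=; rewrite aut_funK. Qed.
Fact aut_Vmul : right_inverse aut1 aut_V aut_mul.
Proof. by move=> f; apply: autP => x /=; rewrite aut_invK. Qed.

HB.instance Definition _ := isGroup.Build (aut G)
  aut_mulA aut_mul1 aut_1mul aut_mulV aut_Vmul.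

Lemma autE1 x : (1 : aut G) x = x. Proof. by []. Qed.
Lemma autEM f g x : (f * g) x = f (g x). Proof. by []. Qed.

Fact inner_morph x : {morph (fun y => x * y * x^-1) : y z / y * z}.
Proof. by move=> y z /=; rewrite !mulgA mulgVK. Qed.
Fact inner_funK x : cancel (fun y => x * y * x^-1) (fun y => x^-1 * y * x).
Proof. by move=> y; rewrite !mulgA mulVg mul1g mulgVK. Qed.
Fact inner_invK x : cancel (fun y => x^-1 * y * x) (fun y => x * y * x^-1).
Proof. by move=> y; rewrite !mulgA mulgV mul1g mulgK. Qed.
Definition inner x : aut G :=
  Aut (@inner_morph x) (@inner_funK x) (@inner_invK x).

Lemma innerE x y : inner x y = x * y * x^-1. Proof. by []. Qed.

Lemma inner1 : inner 1 = 1.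
Proof. by apply: autP => y; rewrite innerE invg1 mulg1 mul1g. Qed.

Lemma innerM x y : inner (x * y) = inner x * inner y.
Proof. by apply: autP => z; rewrite autEM !innerE invgM !mulgA. Qed.

Lemma innerV x : inner x^-1 = (inner x)^-1.
Proof. by apply: (@mulgI _ (inner x)); rewrite -innerM !mulgV inner1. Qed.

Lemma autV_morph f x : f x^-1 = (f x)^-1.
Proof.
have f1 : f 1 = 1 by apply: (@mulgI _ (f 1)); rewrite -aut_morph !mulg1.
by apply: (@mulgI _ (f x)); rewrite -aut_morph !mulgV f1.
Qed.

Lemma inner_conj f x : f * inner x = inner (f x) * f.
Proof. by apply: autP => y; rewrite !autEM !innerE !aut_morph autV_morph. Qed.

End AutGroup.

Section OutGroup.
Variable G : groupType.
Implicit Types (f g h : aut G).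

Definition out_eq : rel (aut G) :=
  fun f g => `[< exists x, f = inner x * g >].

Fact out_eq_refl : reflexive out_eq.
Proof. by move=> f; apply/asboolP; exists 1; rewrite inner1 mul1g. Qed.
Fact out_eq_sym : symmetric out_eq.
Proof.
suff sub f g : out_eq f g -> out_eq g f by move=> f g; apply/idP/idP; apply: sub.
move=> /asboolP[x ->]; apply/asboolP; exists x^-1.
by rewrite innerV mulKg.
Qed.
Fact out_eq_trans : transitive out_eq.
Proof.
move=> f g h /asboolP[x ->] /asboolP[y ->]; apply/asboolP; exists (x * y).
by rewrite innerM mulgA.
Qed.
Canonical out_equiv : equiv_rel (aut G) :=
  EquivRel out_eq out_eq_refl out_eq_sym out_eq_trans.

Definition out : Type := {eq_quot out_equiv}.
HB.instance Definition _ := Choice.on out.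
HB.instance Definition _ := EqQuotient.on out.

Definition outer (f : aut G) : out := \pi_out f.

Lemma outer_eqP f g : outer f = outer g <-> exists x, f = inner x * g.
Proof.
rewrite /outer; split => [/eqP|fg].
  by rewrite piE /= => /asboolP.
by apply/eqP; rewrite piE; apply/asboolP.
Qed.

Lemma outer_inner x : outer (inner x) = outer 1.
Proof. by apply/outer_eqP; exists x; rewrite mulg1. Qed.

Lemma outerP (u : out) : exists f, u = outer f.
Proof. by exists (repr u); rewrite /outer reprK. Qed.

Definition out_one : out := outer 1.
Definition out_inv (u : out) : out := outer (repr u)^-1.
Definition out_mul (u v : out) : out := outer (repr u * repr v).

Lemma repr_outer f : exists x, repr (outer f) = inner x * f.
Proof. by apply/outer_eqP; rewrite /outer reprK. Qed.

Fact out_mulE f g : out_mul (outer f) (outer g) = outer (f * g).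
Proof.
rewrite /out_mul; have [x ->] := repr_outer f; have [y ->] := repr_outer g.
apply/outer_eqP; exists (x * f y).
by rewrite innerM -!mulgA; congr (_ * _); rewrite !mulgA inner_conj.
Qed.

Fact out_invE f : out_inv (outer f) = outer f^-1.
Proof.
rewrite /out_inv; have [x ->] := repr_outer f.
by apply/outer_eqP; exists (f^-1 x^-1); rewrite invgM -innerV inner_conj.
Qed.

Fact out_mulA : associative out_mul.
Proof.
move=> u v w; have [f ->] := outerP u; have [g ->] := outerP v.
by have [h ->] := outerP w; rewrite !out_mulE mulgA.
Qed.
Fact out_mul1 : left_id out_one out_mul.
Proof. by move=> u; have [f ->] := outerP u; rewrite out_mulE mul1g. Qed.
Fact out_1mul : right_id out_one out_mul.
Proof. by move=> u; have [f ->] := outerP u; rewrite out_mulE mulg1. Qed.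
Fact out_mulV : left_inverse out_one out_inv out_mul.
Proof. by move=> u; have [f ->] := outerP u; rewrite out_invE out_mulE mulVg. Qed.
Fact out_Vmul : right_inverse out_one out_inv out_mul.
Proof. by move=> u; have [f ->] := outerP u; rewrite out_invE out_mulE mulgV. Qed.

HB.instance Definition _ := isGroup.Build out
  out_mulA out_mul1 out_1mul out_mulV out_Vmul.

Lemma outerM : {morph outer : f g / f * g}.
Proof. by move=> f g; rewrite -out_mulE. Qed.
Lemma outerV f : outer f^-1 = (outer f)^-1.
Proof. by rewrite -out_invE. Qed.

HB.instance Definition _ := isMultiplicative.Build (aut G) out outer outerM.

End OutGroup.

(* F_n is realised by reduced words; the letter (i, false) stands for x_i and
   (i, true) for x_i^-1. *)

Section FreeGroup.
Variable n : nat.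

Local Notation letter := ('I_n * bool)%type.

Definition linv (a : letter) : letter := (a.1, ~~ a.2).

Definition reduced (w : seq letter) : bool :=
  sorted [rel a b | b != linv a] w.

Record free := Free { word :> seq letter; word_reduced : reduced word }.
HB.instance Definition _ := [isSub for word].
HB.instance Definition _ := [Countable of free by <:].

Implicit Types (a b : letter) (u v w : seq letter).

Definition push a w : seq letter :=
  if w is b :: w' then if b == linv a then w' else a :: w else [:: a].

Lemma linvK : involutive linv. Proof. by case=> i e; rewrite /linv /= negbK. Qed.

Lemma reduced_cons a w : reduced (a :: w) -> reduced w.
Proof. exact: path_sorted. Qed.

Lemma push_reduced a w : reduced w -> reduced (push a w).
Proof.
case: w => [|b w] //= bw; case: eqP => [_|/eqP ba]; first exact: path_sorted bw.
by rewrite /= ba.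
Qed.

Lemma pushE a w : reduced (a :: w) -> push a w = a :: w.
Proof. by case: w => //= b w /andP[/negPf-> _]. Qed.

Lemma pushK a w : reduced w -> push (linv a) (push a w) = w.
Proof.
case: w => [|b w] bw /=; first by rewrite linvK eqxx.
case: eqP => [ba|_] /=; last by rewrite linvK eqxx.
by rewrite -ba pushE.
Qed.

Definition mulw u v : seq letter := foldr push v u.

Lemma mulw_reduced u v : reduced v -> reduced (mulw u v).
Proof. by move=> rv; elim: u => //= a u; apply: push_reduced. Qed.

Lemma mulw0 u : reduced u -> mulw u [::] = u.
Proof.
elim: u => //= a u IHu au; rewrite IHu ?pushE //; exact: reduced_cons au.
Qed.

Lemma mulw_push a u w : reduced u -> reduced w ->
  mulw (push a u) w = push a (mulw u w).
Proof.
case: u => [|b u] //= bu rw; case: eqP => //= ->.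
by have := @pushK (linv a) _ (mulw_reduced u rw); rewrite linvK.
Qed.

Lemma mulwA u v w : reduced v -> reduced w ->
  mulw u (mulw v w) = mulw (mulw u v) w.
Proof.
move=> rv rw; elim: u => //= a u ->; rewrite mulw_push //; exact: mulw_reduced.
Qed.

Definition invw u : seq letter := rev (map linv u).

Lemma invwK : involutive invw.
Proof. by move=> u; rewrite /invw map_rev revK (mapK linvK). Qed.

Lemma invw_reduced u : reduced u -> reduced (invw u).
Proof.
rewrite /reduced /invw rev_sorted sorted_map; apply: sub_sorted => a b /=.
by rewrite linvK eq_sym.
Qed.

Lemma mulVw u w : reduced w -> mulw (invw u) (mulw u w) = w.
Proof.
move=> rw; elim: u => // a u IHu.
have -> : mulw (a :: u) w = push a (mulw u w) by [].
rewrite /invw map_cons rev_cons {1}/mulw foldr_rcons.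
by rewrite pushK ?mulw_reduced.
Qed.

Definition free_one : free := @Free [::] isT.
Definition free_mul (u v : free) : free :=
  Free (mulw_reduced u (word_reduced v)).
Definition free_inv (u : free) : free := Free (invw_reduced (word_reduced u)).

Fact free_mulA : associative free_mul.
Proof. by move=> u v w; apply/val_inj/mulwA; apply: word_reduced. Qed.
Fact free_mul1 : left_id free_one free_mul.
Proof. by move=> u; apply/val_inj. Qed.
Fact free_1mul : right_id free_one free_mul.
Proof. by move=> u; apply/val_inj/mulw0/word_reduced. Qed.
Fact free_mulV : left_inverse free_one free_inv free_mul.
Proof.
move=> u; apply/val_inj => /=.
by rewrite -[X in mulw _ X](mulw0 (word_reduced u)) mulVw.
Qed.
Fact free_Vmul : right_inverse free_one free_inv free_mul.
Proof.
move=> u; have := free_mulV (free_inv u).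
by congr (free_mul _ _ = _); apply/val_inj/invwK.
Qed.

HB.instance Definition _ := isGroup.Build free
  free_mulA free_mul1 free_1mul free_mulV free_Vmul.

Definition gen (i : 'I_n) : free := @Free [:: (i, false)] isT.
Definition basis : set free := range gen.

Section Lift.
Variables (H : groupType) (f : 'I_n -> H).

Definition lift_letter a : H := if a.2 then (f a.1)^-1 else f a.1.
Definition free_lift (u : free) : H := \prod_(a <- word u) lift_letter a.

Lemma lift_linv a : lift_letter (linv a) = (lift_letter a)^-1.
Proof. by case: a => i [] //=; rewrite /lift_letter /= invgK. Qed.

Lemma free_lift_push a w :
  \prod_(b <- push a w) lift_letter b =
  lift_letter a * \prod_(b <- w) lift_letter b.
Proof.
case: w => [|b w] /=; first by rewrite !big_cons.
by case: eqP => [->|_]; rewrite !big_cons // lift_linv mulVKg.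
Qed.

Lemma free_liftM : {morph free_lift : u v / u * v}.
Proof.
move=> u v; rewrite /free_lift /= /mulw; elim: (word u) => /= [|a w IHw].
  by rewrite big_nil mul1g.
by rewrite free_lift_push IHw big_cons mulgA.
Qed.

Lemma free_lift_gen i : free_lift (gen i) = f i.
Proof. by rewrite /free_lift big_seq1. Qed.

End Lift.

Lemma free_ind (P : free -> Prop) :
  P 1 -> (forall i x, P x -> P (gen i * x)) ->
  (forall i x, P x -> P ((gen i)^-1 * x)) -> forall x, P x.
Proof.
move=> P1 Pg PV [w rw]; elim: w => [|a w IHw] in rw *.
  by congr P: P1; apply/val_inj.
have rw' := reduced_cons rw.
have -> : Free rw = lift_letter gen a * Free rw'.
  apply/val_inj; rewrite /lift_letter; case: a rw => i [] rw /=; exact/esym/pushE.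
by rewrite /lift_letter; case: ifP => _; [apply: PV | apply: Pg].
Qed.

Lemma free_morph_eq (H : groupType) (f g : free -> H) :
  {morph f : x y / x * y} -> {morph g : x y / x * y} ->
  (forall i, f (gen i) = g (gen i)) -> f =1 g.
Proof.
move=> fM gM fg.
have f1 : f 1 = 1 by apply: (@mulgI _ (f 1)); rewrite -fM !mulg1.
have g1 : g 1 = 1 by apply: (@mulgI _ (g 1)); rewrite -gM !mulg1.
have fV x : f x^-1 = (f x)^-1 by apply: (@mulgI _ (f x)); rewrite -fM !mulgV.
have gV x : g x^-1 = (g x)^-1 by apply: (@mulgI _ (g x)); rewrite -gM !mulgV.
elim/free_ind => [|i x fgx|i x fgx]; first by rewrite f1.
- by rewrite fM gM fg fgx.
- by rewrite fM gM fV gV fg fgx.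
Qed.

(* The maps expsum i are the coordinates of the abelianization F_n -> Z^n. *)

Definition letter_exp (i : 'I_n) a : int :=
  (if a.1 == i then (-1) ^+ a.2 else 0)%R.
Definition expsum (i : 'I_n) (x : free) : int :=
  (\sum_(a <- word x) letter_exp i a)%R.

Lemma expsumM i (x y : free) : (expsum i (x * y)%g = expsum i x + expsum i y)%R.
Proof.
rewrite /expsum /= /mulw; elim: (word x) => /= [|a w IHw].
  by rewrite big_nil add0r.
have -> u : (\sum_(b <- push a u) letter_exp i b =
             letter_exp i a + \sum_(b <- u) letter_exp i b)%R.
  case: u => [|b u] /=; first by rewrite !big_cons.
  case: eqP => [->|_]; rewrite !big_cons // addrA [X in (X + _)%R](_ : _ = 0%R) ?add0r //.
  by rewrite /letter_exp /=; case: ifP; case: a.2; rewrite ?addr0 //= ?addNr ?subrr.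
by rewrite IHw big_cons addrA.
Qed.

Lemma expsum1 i : expsum i (1 : free) = 0%R.
Proof. by rewrite /expsum big_nil. Qed.

Lemma expsumV i (x : free) : expsum i x^-1 = (- expsum i x)%R.
Proof. by apply/eqP; rewrite -addr_eq0 -expsumM mulVg expsum1. Qed.

Lemma expsum_gen i j : expsum i (gen j) = (i == j)%:R%R.
Proof. by rewrite /expsum big_seq1 /letter_exp /= eq_sym; case: eqP. Qed.

Lemma expsum_morph (f : free -> free) i x : {morph f : x y / x * y} ->
  expsum i (f x) = (\sum_j expsum i (f (gen j)) * expsum j x)%R.
Proof.
move=> fM.
have f1 : f 1 = 1 by apply: (@mulgI _ (f 1)); rewrite -fM !mulg1.
have fV y : f y^-1 = (f y)^-1 by apply: (@mulgI _ (f y)); rewrite -fM !mulgV.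
have sum_gen k : (expsum i (f (gen k)) =
    \sum_j expsum i (f (gen j)) * expsum j (gen k))%R.
  rewrite (bigD1 k) //= expsum_gen eqxx mulr1 big1 ?addr0 // => j /negPf jk.
  by rewrite expsum_gen jk mulr0.
elim/free_ind: x => [|k x IHx|k x IHx].
- by rewrite f1 expsum1 big1 // => j _; rewrite expsum1 mulr0.
- rewrite fM expsumM sum_gen IHx -big_split /=; apply: eq_bigr => j _.
  by rewrite expsumM mulrDr.
- rewrite fM fV expsumM expsumV sum_gen IHx -sumrN -big_split /=.
  by apply: eq_bigr => j _; rewrite expsumM expsumV mulrDr mulrN.
Qed.

Definition iota_fun : free -> free := free_lift (fun i => (gen i)^-1).

Fact iota_funK : cancel iota_fun iota_fun.
Proof.
apply: (@free_morph_eq _ (iota_fun \o iota_fun) id) => // [x y|i] /=.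
  by rewrite /iota_fun !free_liftM.
by rewrite /iota_fun free_lift_gen; apply/val_inj; rewrite /free_lift big_seq1.
Qed.

Definition iota : aut free :=
  Aut (free_liftM (fun i => (gen i)^-1)) iota_funK iota_funK.

Lemma iota_gen i : iota (gen i) = (gen i)^-1.
Proof. exact: free_lift_gen. Qed.

End FreeGroup.

Arguments gen {n} i.
Arguments basis n : clear implicits.
Arguments iota n : clear implicits.

Section GLZ.
Variable n : nat.

Record GLZ := MkGLZ { GLZ_mx :> 'M[int]_n; GLZ_unit : GLZ_mx \in unitmx }.
HB.instance Definition _ := [isSub for GLZ_mx].
HB.instance Definition _ := [Choice of GLZ by <:].

Fact GLZ_one_unit : (1%:M : 'M[int]_n)%R \in unitmx. Proof. exact: unitmx1. Qed.
Fact GLZ_mul_unit (A B : GLZ) : (A *m B)%R \in unitmx.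
Proof. by rewrite unitmx_mul !GLZ_unit. Qed.
Fact GLZ_inv_unit (A : GLZ) : invmx A \in unitmx.
Proof. by rewrite unitmx_inv GLZ_unit. Qed.

Definition GLZ_one := MkGLZ GLZ_one_unit.
Definition GLZ_mul (A B : GLZ) := MkGLZ (GLZ_mul_unit A B).
Definition GLZ_inv (A : GLZ) := MkGLZ (GLZ_inv_unit A).

Fact GLZ_mulA : associative GLZ_mul.
Proof. by move=> A B C; apply/val_inj/mulmxA. Qed.
Fact GLZ_mul1 : left_id GLZ_one GLZ_mul.
Proof. by move=> A; apply/val_inj/mul1mx. Qed.
Fact GLZ_1mul : right_id GLZ_one GLZ_mul.
Proof. by move=> A; apply/val_inj/mulmx1. Qed.
Fact GLZ_mulV : left_inverse GLZ_one GLZ_inv GLZ_mul.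
Proof. by move=> A; apply/val_inj/mulVmx/GLZ_unit. Qed.
Fact GLZ_Vmul : right_inverse GLZ_one GLZ_inv GLZ_mul.
Proof. by move=> A; apply/val_inj/mulmxV/GLZ_unit. Qed.

HB.instance Definition _ := isGroup.Build GLZ
  GLZ_mulA GLZ_mul1 GLZ_1mul GLZ_mulV GLZ_Vmul.

(* Column j holds the class of f x_j in H_1(F_n) = Z^n. *)
Definition abel_mx (f : aut (free n)) : 'M[int]_n :=
  \matrix_(i, j) expsum i (f (gen j)).

Lemma abel_mxM f g : abel_mx (f * g) = (abel_mx f *m abel_mx g)%R.
Proof.
apply/matrixP => i j; rewrite !mxE autEM (expsum_morph _ _ (aut_morph f)).
by apply: eq_bigr => k _; rewrite !mxE.
Qed.

Lemma abel_mx1 : abel_mx 1 = 1%:M%R.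
Proof. by apply/matrixP => i j; rewrite !mxE autE1 expsum_gen. Qed.

Lemma abel_mx_inner x : abel_mx (inner x) = 1%:M%R.
Proof.
apply/matrixP => i j; rewrite !mxE innerE !expsumM expsumV expsum_gen.
by rewrite [(_ + (i == j)%:R)%R]addrC addrK.
Qed.

Fact abel_mx_unit f : abel_mx f \in unitmx.
Proof.
have /mulmx1_unit[] // : (abel_mx f *m abel_mx f^-1%g = 1%:M)%R.
by rewrite -abel_mxM mulgV abel_mx1.
Qed.

Definition abel (f : aut (free n)) : GLZ := MkGLZ (abel_mx_unit f).

Lemma abelM : {morph abel : f g / f * g}.
Proof. by move=> f g; apply/val_inj/abel_mxM. Qed.

Lemma abel_inner x : abel (inner x) = 1.
Proof. exact/val_inj/abel_mx_inner. Qed.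

(* The value does not depend on the representative, see abel_outE. *)
Definition abel_out (u : out (free n)) : GLZ := abel (repr u).

Lemma abel_outE f : abel_out (outer f) = abel f.
Proof.
by rewrite /abel_out; have [x ->] := repr_outer f; rewrite abelM abel_inner mul1g.
Qed.

Lemma abel_outM : {morph abel_out : u v / u * v}.
Proof.
move=> u v; have [f ->] := outerP u; have [g ->] := outerP v.
by rewrite -outerM !abel_outE abelM.
Qed.

HB.instance Definition _ :=
  isMultiplicative.Build (out (free n)) GLZ abel_out abel_outM.

End GLZ.

Section Hyperelliptic.
Variable n : nat.

Definition HOut : set (out (free n)) := centralizer (outer (iota n)).

Definition Torelli : set (out (free n)) := kernel (@abel_out n).

Definition ST : set (out (free n)) := HOut `&` Torelli.

Definition hyperelliptic (u : out (free n)) : Prop := commute u (outer (iota n)).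

Definition hyperelliptic_basis (Y : set (free n)) : Prop :=
  exists2 theta : aut (free n), hyperelliptic (outer theta) & Y = theta @` basis n.

Definition doubled_commutator_transvection : set (aut (free n)) := [set tau |
  exists Y : set (free n), hyperelliptic_basis Y /\
  exists a b c : free n,
    [/\ Y a, Y b & Y c] /\ [/\ a <> b, a <> c & b <> c] /\
    tau c = commutator a b * c * commutator b^-1 a^-1 /\
    forall y, Y y -> y <> c -> tau y = y].

End Hyperelliptic.

Arguments HOut n : clear implicits.
Arguments Torelli n : clear implicits.
Arguments ST n : clear implicits.
Arguments doubled_commutator_transvection n : clear implicits.

(* Main.v *)
(** The free group F_n is the subgroup of even elements of the free product W of
    n+1 groups of order two with generators a_0, ..., a_n, where x_i = a_0 a_i,
    and iota is the conjugation by a_0.  Hyperelliptic automorphisms are those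
    which extend to W.  By Nielsen reduction the automorphisms of W are, up to
    permutations of the generators, products of partial conjugations
    c_ij : a_i |-> a_j a_i a_j, and the doubled commutator transvections are the
    conjugates of the relators (c_pj c_pk c_pl)^2.  Hence one has to show that a
    product of partial conjugations which acts trivially on homology is trivial
    modulo these relators and the conjugations by even elements.

    This goes by induction on n.  Let W act on the real line, a_n by the
    reflection in 1 and the other generators by the reflection in 0.  An
    automorphism changes the positions of these n+1 reflection points, and c_ij
    makes the i-th point jump to its mirror image in the j-th one.  By peak
    reduction on sequences of such jumps, an automorphism which does not change
    the positions is, modulo the relators, the composite of an automorphism of
    <a_0, ..., a_{n-1}> and of a conjugation of a_n alone by an even element u
    of this subgroup.  If it acts trivially on homology, then so do both
    factors.  The first one is trivial by induction, up to a conjugation of the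
    same kind as the second.  The second one is trivial since u is in the
    commutator subgroup of the even elements, and the conjugations of a_n by
    a_0 a_i and by a_0 a_k commute modulo the relators. *)

From HB Require Import structures.
From mathcomp Require Import all_boot all_order all_algebra.
From mathcomp Require Import boolp classical_sets.
From mathcomp Require Import zify.
Require Import Defs.

Set Implicit Arguments.
Unset Strict Implicit.
Unset Printing Implicit Defensive.

Import Order.TTheory GRing.Theory Num.Theory.

Local Open Scope quotient_scope.
Local Open Scope classical_set_scope.
Local Open Scope group_scope.

Lemma morph_one (G H : groupType) (f : G -> H) :
  {morph f : x y / x * y} -> f 1 = 1.
Proof. by move=> fM; apply: (@mulgI _ (f 1)); rewrite -fM !mulg1. Qed.

Lemma morph_inv (G H : groupType) (f : G -> H) :
  {morph f : x y / x * y} -> {morph f : x / x^-1}.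
Proof.
by move=> fM x; apply: (@mulgI _ (f x)); rewrite -fM !mulgV (morph_one fM).
Qed.

Lemma aut_one (G : groupType) (f : aut G) : f 1 = 1.
Proof. exact: morph_one (aut_morph f). Qed.

(** * Free products of groups of order two *)

Section Coxeter.
Variable N : nat.
Local Notation letter := 'I_N.
Implicit Types (i j k : letter) (u v w : seq letter).

Definition alternating w : bool := sorted [rel i j | i != j] w.

Record cox := Cox { cword :> seq letter; cword_alternating : alternating cword }.
HB.instance Definition _ := [isSub for cword].
HB.instance Definition _ := [Countable of cox by <:].

Definition cpush i w : seq letter :=
  if w is j :: w' then if i == j then w' else i :: w else [:: i].

Definition cmulw u v : seq letter := foldr cpush v u.

Lemma alternating_cons i w : alternating (i :: w) -> alternating w.
Proof. exact: path_sorted. Qed.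

Lemma cpush_alternating i w : alternating w -> alternating (cpush i w).
Proof.
case: w => [|j w] //= aw; case: eqP => [_|/eqP ij]; first exact: path_sorted aw.
by rewrite /= ij.
Qed.

Lemma cpushE i w : alternating (i :: w) -> cpush i w = i :: w.
Proof. by case: w => //= j w /andP[/negPf->]. Qed.

Lemma cpushK i w : alternating w -> cpush i (cpush i w) = w.
Proof.
case: w => [|j w] aw /=; first by rewrite eqxx.
by case: eqP => [->|_] /=; [rewrite cpushE|rewrite eqxx].
Qed.

Lemma cmulw_alternating u v : alternating v -> alternating (cmulw u v).
Proof. by move=> av; elim: u => //= i u; apply: cpush_alternating. Qed.

Lemma cmulw_cat u v : alternating (u ++ v) -> cmulw u v = u ++ v.
Proof.
elim: u => //= i u IHu aiu; have auv := alternating_cons aiu.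
by rewrite IHu // cpushE.
Qed.

Lemma cmulw0 u : alternating u -> cmulw u [::] = u.
Proof. by move=> au; rewrite cmulw_cat cats0. Qed.

Lemma cmulw_push i u w : alternating w ->
  cmulw (cpush i u) w = cpush i (cmulw u w).
Proof.
case: u => [|j u] //= aw; case: eqP => //= ->.
by rewrite cpushK ?cmulw_alternating.
Qed.

Lemma cmulwA u v w : alternating w ->
  cmulw u (cmulw v w) = cmulw (cmulw u v) w.
Proof. by move=> aw; elim: u => //= i u ->; rewrite cmulw_push. Qed.

Lemma rev_alternating u : alternating u -> alternating (rev u).
Proof.
by rewrite /alternating rev_sorted; apply: sub_sorted => i j /=; rewrite eq_sym.
Qed.

Lemma cmulVw u w : alternating w -> cmulw (rev u) (cmulw u w) = w.
Proof.
move=> aw; elim: u => // i u IHu.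
by rewrite rev_cons /cmulw foldr_rcons /= cpushK ?cmulw_alternating.
Qed.

Definition cox_one : cox := @Cox [::] isT.
Definition cox_mul (u v : cox) : cox :=
  Cox (cmulw_alternating u (cword_alternating v)).
Definition cox_inv (u : cox) : cox := Cox (rev_alternating (cword_alternating u)).

Fact cox_mulA : associative cox_mul.
Proof. by move=> u v w; apply/val_inj/cmulwA/cword_alternating. Qed.
Fact cox_mul1 : left_id cox_one cox_mul.
Proof. by move=> u; apply/val_inj. Qed.
Fact cox_1mul : right_id cox_one cox_mul.
Proof. by move=> u; apply/val_inj/cmulw0/cword_alternating. Qed.
Fact cox_mulV : left_inverse cox_one cox_inv cox_mul.
Proof.
move=> u; apply/val_inj => /=.
by rewrite -[X in cmulw _ X](cmulw0 (cword_alternating u)) cmulVw.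
Qed.
Fact cox_Vmul : right_inverse cox_one cox_inv cox_mul.
Proof.
move=> u; have := cox_mulV (cox_inv u).
by congr (cox_mul _ _ = _); apply/val_inj/revK.
Qed.

HB.instance Definition _ := isGroup.Build cox
  cox_mulA cox_mul1 cox_1mul cox_mulV cox_Vmul.

Definition refl i : cox := @Cox [:: i] isT.

Lemma refl2 i : refl i * refl i = 1.
Proof. by apply/val_inj; rewrite /= eqxx. Qed.

Lemma mulRK i (x : cox) : x * refl i * refl i = x.
Proof. by rewrite -mulgA refl2 mulg1. Qed.

Lemma reflV i : (refl i)^-1 = refl i.
Proof. exact/val_inj. Qed.

Lemma refl_inj : injective refl.
Proof. by move=> i j /(congr1 cword) []. Qed.

Lemma cox_cons i w (aiw : alternating (i :: w)) :
  Cox aiw = refl i * Cox (alternating_cons aiw).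
Proof. by apply/val_inj; rewrite /= cpushE. Qed.

Lemma cox_ind (P : cox -> Prop) :
  P 1 -> (forall i x, P x -> P (refl i * x)) -> forall x, P x.
Proof.
move=> P1 Pr [w aw]; elim: w => [|i w IHw] in aw *.
  by congr P: P1; apply/val_inj.
by rewrite cox_cons; apply: Pr.
Qed.

Lemma cox_morph_eq (H : groupType) (f g : cox -> H) :
  {morph f : x y / x * y} -> {morph g : x y / x * y} ->
  (forall i, f (refl i) = g (refl i)) -> f =1 g.
Proof.
move=> fM gM fg.
elim/cox_ind => [|i x fgx]; first by rewrite (morph_one fM) (morph_one gM).
by rewrite fM gM fg fgx.
Qed.

Section Lift.
Variables (H : groupType) (f : letter -> H).
Hypothesis f2 : forall i, f i * f i = 1.

Definition cox_lift (x : cox) : H := \prod_(i <- cword x) f i.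

Lemma cox_lift_push i w :
  \prod_(j <- cpush i w) f j = f i * \prod_(j <- w) f j.
Proof.
case: w => [|j w] /=; first by rewrite !big_cons.
by case: eqP => [->|_]; rewrite !big_cons // mulgA f2 mul1g.
Qed.

Lemma cox_liftM : {morph cox_lift : x y / x * y}.
Proof.
move=> x y; rewrite /cox_lift /= /cmulw; elim: (cword x) => /= [|i w IHw].
  by rewrite big_nil mul1g.
by rewrite cox_lift_push IHw big_cons mulgA.
Qed.

Lemma cox_lift_refl i : cox_lift (refl i) = f i.
Proof. by rewrite /cox_lift big_seq1. Qed.

End Lift.

Section LiftAut.
Variables f g : letter -> cox.
Hypotheses (f2 : forall i, f i * f i = 1) (g2 : forall i, g i * g i = 1).
Hypotheses (fg : forall i, cox_lift f (g i) = refl i).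
Hypotheses (gf : forall i, cox_lift g (f i) = refl i).

Fact cox_lift_funK : cancel (cox_lift f) (cox_lift g).
Proof.
apply: (@cox_morph_eq _ (cox_lift g \o cox_lift f) id) => // [x y|i] /=.
  by rewrite !cox_liftM.
by rewrite cox_lift_refl gf.
Qed.

Fact cox_lift_invK : cancel (cox_lift g) (cox_lift f).
Proof.
apply: (@cox_morph_eq _ (cox_lift f \o cox_lift g) id) => // [x y|i] /=.
  by rewrite !cox_liftM.
by rewrite cox_lift_refl fg.
Qed.

Definition cox_aut : aut cox := Aut (cox_liftM f2) cox_lift_funK cox_lift_invK.

Lemma cox_autE i : cox_aut (refl i) = f i.
Proof. exact: cox_lift_refl. Qed.

End LiftAut.

Lemma cox_aut_eq (f g : aut cox) : (forall i, f (refl i) = g (refl i)) -> f = g.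
Proof. by move=> fg; apply/autP/cox_morph_eq => //; apply: aut_morph. Qed.

(* The alternating sum of the values of [phi] along a word: if [refl i] is the
   point reflection of the line in [phi i], then a word of odd length is the
   reflection in [alt phi w], and one of even length the translation by twice
   this number. *)
Definition altw (phi : letter -> int) w : int :=
  foldr (fun i t => (phi i - t)%R) 0%R w.
Definition alt phi (x : cox) : int := altw phi (cword x).

Definition parity (x : cox) : bool := odd (size (cword x)).

Lemma parity_push i w : odd (size (cpush i w)) = ~~ odd (size w).
Proof. by case: w => [|j w] //=; case: eqP => //= _; rewrite negbK. Qed.

Lemma parityM x y : parity (x * y) = parity x (+) parity y.
Proof.
rewrite /parity /= /cmulw; elim: (cword x) => //= i w IHw.
by rewrite parity_push IHw addNb.
Qed.

Lemma parity_refl i : parity (refl i). Proof. by []. Qed.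

Lemma parity1 : parity 1 = false. Proof. by []. Qed.

Lemma parityV x : parity x^-1 = parity x.
Proof. by rewrite /parity /= size_rev. Qed.

Lemma altw_push phi i w : altw phi (cpush i w) = (phi i - altw phi w)%R.
Proof. by case: w => [|j w] //=; case: eqP => [->|_] //=; rewrite subKr. Qed.

Lemma alt_refl phi i : alt phi (refl i) = phi i.
Proof. by rewrite /alt /= subr0. Qed.

Lemma alt1 phi : alt phi 1 = 0%R. Proof. by []. Qed.

Lemma alt_reflM phi i x : alt phi (refl i * x) = (phi i - alt phi x)%R.
Proof. by rewrite /alt /= altw_push. Qed.

Lemma altM phi x y : alt phi (x * y) =
  (if parity x then alt phi x - alt phi y else alt phi x + alt phi y)%R.
Proof.
elim/cox_ind: x => [|i x IHx]; first by rewrite mul1g parity1 alt1 add0r.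
rewrite -mulgA !alt_reflM IHx parityM parity_refl /=.
by case: (parity x) => /=; lia.
Qed.

Lemma altV phi x : alt phi x^-1 = (if parity x then alt phi x else - alt phi x)%R.
Proof.
have := altM phi x x^-1; rewrite mulgV alt1; case: (parity x); lia.
Qed.

(* An involution has a palindromic word, of odd length since adjacent letters
   differ. *)
Lemma involution_cword (x : cox) : x * x = 1 -> x != 1 ->
  exists w i, cword x = w ++ i :: rev w.
Proof.
move=> xx x1; have xE : rev x = cword x.
  by have /(congr1 cword) : x^-1 = x by apply: (@mulgI _ x); rewrite mulgV xx.
have : cword x != [::] by apply: contraNneq x1 => x0; apply/eqP/val_inj.
move: (cword x) xE (cword_alternating x) => w; clear; have [m] := ubnP (size w).
elim: m w => // m IHm [|i w] // wm; case/lastP: w wm => [|w j] wm.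
  by move=> *; exists [::], i.
rewrite rev_cons rev_rcons /= => -[-> /rcons_inj[rw]] aw _.
have aw' : alternating w.
  by move/alternating_cons: aw; rewrite -cats1 => /cat_sorted2[].
case: w wm rw aw aw' => [|k w] wm rw aw aw'; first by move: aw; rewrite /= eqxx.
have [||u [k' E]] := IHm (k :: w) _ rw aw'; rewrite //.
  by move: wm; rewrite /= !size_rcons; lia.
exists (i :: u), k'.
by rewrite E /= rev_cons rcons_cat.
Qed.

Lemma involution_parity (x : cox) : x * x = 1 -> x != 1 -> parity x.
Proof.
move=> xx x1; have [w [i xE]] := involution_cword xx x1.
by rewrite /parity xE size_cat /= size_rev addnS /= addnn odd_double.
Qed.

Lemma aut_involution (f : aut cox) i : f (refl i) * f (refl i) = 1.
Proof. by rewrite -aut_morph refl2 aut_one. Qed.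

Lemma aut_refl_neq1 (f : aut cox) i : f (refl i) != 1.
Proof.
apply/eqP; rewrite -(aut_one f) => /(can_inj (aut_funK f)) /(congr1 cword).
by [].
Qed.

Lemma aut_parity_refl (f : aut cox) i : parity (f (refl i)).
Proof. exact: involution_parity (aut_involution f i) (aut_refl_neq1 f i). Qed.

Lemma aut_parity (f : aut cox) x : parity (f x) = parity x.
Proof.
elim/cox_ind: x => [|i x IHx]; first by rewrite aut_one.
by rewrite aut_morph !parityM aut_parity_refl IHx parity_refl.
Qed.

(** Each [f (refl i)] has odd length, so it also acts as a reflection; composing the action with [f]
    only changes the reflection points. *)
Lemma alt_aut phi (f : aut cox) x :
  alt phi (f x) = alt (fun i => alt phi (f (refl i))) x.
Proof.
elim/cox_ind: x => [|i x IHx]; first by rewrite aut_one !alt1.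
by rewrite aut_morph (altM phi) aut_parity_refl IHx alt_reflM.
Qed.

Lemma alt_shift phi t x :
  alt (fun i => phi i + t)%R x = (alt phi x + (if parity x then t else 0))%R.
Proof.
elim/cox_ind: x => [|i x IHx]; first by rewrite !alt1.
by rewrite !alt_reflM IHx parityM parity_refl /=; case: parity => /=; lia.
Qed.

End Coxeter.

(** * Partial conjugations *)

Section PartialConjugations.
Variable N : nat.
Implicit Types (i j k l m p q : 'I_N).

Definition pc_fun i j k : cox N :=
  if k == i then refl j * refl i * refl j else refl k.

Fact pc_fun2 i j k : pc_fun i j k * pc_fun i j k = 1.
Proof. by rewrite /pc_fun; case: ifP => _; rewrite ?mulgA ?mulRK refl2. Qed.

Fact pc_funK i j k : cox_lift (pc_fun i j) (pc_fun i j k) = refl k.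
Proof.
have f2 := pc_fun2 i j; rewrite {2}/pc_fun.
have [->|ki] := eqVneq k i; rewrite ?cox_liftM // !cox_lift_refl /pc_fun;
  last by rewrite (negPf ki).
by rewrite eqxx; case: eqP => [->|_]; rewrite ?mulgA ?mulRK ?refl2 ?mul1g.
Qed.

Definition pc i j : aut (cox N) :=
  cox_aut (pc_fun2 i j) (pc_fun2 i j) (@pc_funK i j) (@pc_funK i j).

Lemma pc_eq i j : pc i j (refl i) = refl j * refl i * refl j.
Proof. by rewrite cox_autE /pc_fun eqxx. Qed.

Lemma pc_neq i j k : k != i -> pc i j (refl k) = refl k.
Proof. by rewrite cox_autE /pc_fun => /negPf->. Qed.

Lemma pc_target i j : pc i j (refl j) = refl j.
Proof.
by have [->|ji] := eqVneq j i; rewrite ?pc_eq ?mulRK // pc_neq.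
Qed.

Lemma pc_eq1 i : pc i i = 1.
Proof.
apply: cox_aut_eq => k; rewrite autE1.
by have [->|ki] := eqVneq k i; rewrite ?pc_target ?pc_neq.
Qed.

Lemma pc2 i j : pc i j * pc i j = 1.
Proof.
apply: cox_aut_eq => k; rewrite autE1 autEM.
have [->|ki] := eqVneq k i; last by rewrite !pc_neq.
by rewrite pc_eq !aut_morph pc_eq pc_target !mulgA refl2 mul1g !mulRK.
Qed.

Lemma pcV i j : (pc i j)^-1 = pc i j.
Proof. by apply: (@mulgI _ (pc i j)); rewrite mulgV pc2. Qed.

Lemma pc_comm i j k l : i != k -> i != l -> k != j ->
  commute (pc i j) (pc k l).
Proof.
move=> ik il kj; have ki : k != i by rewrite eq_sym.
have li : l != i by rewrite eq_sym.
have jk : j != k by rewrite eq_sym.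
apply: cox_aut_eq => m; rewrite !autEM.
have [->|mi] := eqVneq m i; last have [->|mk] := eqVneq m k.
- by rewrite (pc_neq _ ik) pc_eq !aut_morph !(pc_neq _ ik, pc_neq _ jk).
- by rewrite (pc_neq _ ki) pc_eq !aut_morph !(pc_neq _ ki, pc_neq _ li).
- by rewrite !(pc_neq _ mi, pc_neq _ mk).
Qed.

Lemma pc_block i j k : i != k -> j != k ->
  commute (pc i j) (pc i k * pc j k).
Proof.
move=> ik jk; have [->|ij] := eqVneq i j.
  by rewrite pc_eq1 /commute mulg1 mul1g.
have ki : k != i by rewrite eq_sym.
have kj : k != j by rewrite eq_sym.
have ji : j != i by rewrite eq_sym.
apply: cox_aut_eq => m; rewrite !autEM.
have [->|mi] := eqVneq m i; last have [->|mj] := eqVneq m j.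
- rewrite !(pc_neq _ ij, pc_neq _ ki, pc_neq _ ji, pc_neq _ kj).
  rewrite !(pc_neq _ ij, pc_neq _ ki, pc_neq _ ji, pc_eq, pc_target, aut_morph).
  by rewrite !mulgA !mulRK.
- by rewrite !(pc_neq _ ki, pc_neq _ ji, pc_neq _ kj, pc_eq, pc_target, aut_morph).
- by rewrite !(pc_neq _ mi, pc_neq _ mj).
Qed.

(** Every factor fixes [u] and conjugates only its own generator, so the conjugations do not
    interfere. *)
Lemma prod_conj_refl (P : pred 'I_N) (F : 'I_N -> aut (cox N)) u r k :
    uniq r -> (forall m, P m -> F m u = u) ->
    (forall m, P m -> F m (refl m) = u * refl m * u^-1) ->
    (forall m l, P m -> l != m -> F m (refl l) = refl l) ->
  (\prod_(m <- r | P m) F m) (refl k) =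
  if (k \in r) && P k then u * refl k * u^-1 else refl k.
Proof.
move=> + Fu Fm Fl; elim: r => [|m r IHr] /=; first by rewrite big_nil.
move=> /andP[mr /IHr{}IHr]; rewrite big_cons inE.
have [E|km] /= := eqVneq k m.
  rewrite E in IHr *; rewrite (negPf mr) in IHr.
  by case Pm: (P m); rewrite ?autEM IHr ?Fm.
case Pm: (P m); last exact: IHr.
rewrite autEM IHr; case: ifP => _; last exact: Fl.
by rewrite !aut_morph autV_morph Fu // Fl.
Qed.

Lemma prod_pc (P : pred 'I_N) j k :
  (\prod_(m | P m) pc m j) (refl k) =
  if P k then refl j * refl k * refl j else refl k.
Proof.
rewrite (@prod_conj_refl P _ (refl j)) ?index_enum_uniq ?mem_index_enum ?reflV //.
- by move=> m _; rewrite pc_target.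
- by move=> m _; rewrite pc_eq.
- by move=> m l _; apply: pc_neq.
Qed.

(** Both sides conjugate [refl j] and [refl l] by [refl j * refl l]; the product over [m] cancels
    this conjugation on the other generators. *)
Lemma pc_inner j l : j != l ->
  pc l j * pc j l = inner (refl j * refl l) *
    \prod_(m | (m != j) && (m != l)) (pc m j * pc m l).
Proof.
move=> jl; have lj : l != j by rewrite eq_sym.
apply: cox_aut_eq => k; rewrite !autEM.
rewrite (@prod_conj_refl _ _ (refl l * refl j)) ?index_enum_uniq //; first last.
- by move=> m k' _ km; rewrite autEM !pc_neq.
- move=> m /andP[mj ml]; have jm : j != m by rewrite eq_sym.
  rewrite autEM pc_eq !aut_morph pc_eq pc_neq 1?eq_sym //.
  by rewrite invgM !reflV !mulgA.
- by move=> m /andP[mj ml]; rewrite autEM !aut_morph !pc_neq // eq_sym.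
rewrite mem_index_enum innerE !invgM !reflV andTb.
have [->|kj] := eqVneq k j; last have [->|kl] := eqVneq k l.
- rewrite -[X in refl j * refl l * X * _]/(refl j).
  by rewrite pc_eq !aut_morph (pc_neq _ jl) pc_eq !mulgA !mulRK.
- rewrite -[X in refl j * refl l * X * _]/(refl l).
  by rewrite (pc_neq _ lj) pc_eq !mulgA !mulRK.
- rewrite -[X in refl j * refl l * X * _]/
    (refl l * refl j * refl k * (refl j * refl l)).
  rewrite (pc_neq _ kj) (pc_neq _ kl) !mulgA.
  by rewrite !mulRK refl2 mul1g ?mulRK.
Qed.

(** Modulo conjugations by even elements, a move of [i] is traded for moves of the other generators;
    this serves to keep frog [ord0] at rest. *)
Lemma pc_from_others i j : j != i ->
  pc i j = inner (refl j * refl i) *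
    ((\prod_(m | m != i) pc m i) *
     (\prod_(m | (m != i) && (m != j)) pc m j)).
Proof.
move=> ji; have ij : i != j by rewrite eq_sym.
have Pi : (\prod_(m | m != i) pc m i) (refl i) = refl i by rewrite prod_pc eqxx.
have Pk k : k != i ->
    (\prod_(m | m != i) pc m i) (refl k) = refl i * refl k * refl i.
  by rewrite prod_pc => ->.
apply: cox_aut_eq => k; rewrite !autEM prod_pc innerE invgM !reflV.
have [->|ki] := eqVneq k i; last have [->|kj] := eqVneq k j.
- by rewrite -[X in (\prod_(m | m != i) pc m i) X]/(refl i) Pi pc_eq !mulgA mulRK.
- rewrite -[X in (\prod_(m | m != i) pc m i) X]/(refl j) Pk // pc_target !mulgA.
  by rewrite !mulRK ?refl2 ?mul1g.
- rewrite -[X in (\prod_(m | m != i) pc m i) X]/(refl j * refl k * refl j).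
  by rewrite !aut_morph !Pk // pc_neq // !mulgA !mulRK ?refl2 ?mul1g ?mulRK.
Qed.

(* When [k] is the letter [ord0], this restricts to the doubled commutator
   transvection [x_p |-> [x_l, x_j] x_p [x_j^-1, x_l^-1]] of the even subgroup,
   where [x_i = refl ord0 * refl i]. *)
Definition pc_relator p j k l : aut (cox N) :=
  pc p j * pc p k * pc p l * (pc p j * pc p k * pc p l).

Lemma pc_relatorE p j k l m : j != p -> k != p -> l != p ->
  pc_relator p j k l (refl m) =
  if m == p then refl l * refl k * refl j * (refl l * refl k * refl j) * refl p *
    (refl j * refl k * refl l * (refl j * refl k * refl l)) else refl m.
Proof.
move=> jp kp lp; rewrite /pc_relator !autEM.
have [->|mp] := eqVneq m p; last by rewrite !pc_neq.
by rewrite !(pc_neq _ lp, pc_neq _ kp, pc_neq _ jp, pc_eq, aut_morph) !mulgA.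
Qed.

End PartialConjugations.

(** * Nielsen reduction *)

Section Nielsen.
Variable N : nat.
Implicit Types (i j k : 'I_N) (u v w : seq 'I_N) (f : aut (cox N)).

Definition pc_seq (r : seq ('I_N * 'I_N)) : aut (cox N) :=
  \prod_(x <- r) pc x.1 x.2.

Definition off_diag (r : seq ('I_N * 'I_N)) := all [pred x | x.1 != x.2] r.

Lemma pc_seq_cat r1 r2 : pc_seq (r1 ++ r2) = pc_seq r1 * pc_seq r2.
Proof. exact: big_cat. Qed.

Lemma off_diag_cat (r1 r2 : seq ('I_N * 'I_N)) :
  off_diag r1 -> off_diag r2 -> off_diag (r1 ++ r2).
Proof. by rewrite /off_diag all_cat => -> ->. Qed.

Lemma pc_seqV r : (pc_seq r)^-1 = pc_seq (rev r).
Proof.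
rewrite /pc_seq -[r in LHS]revK -prodgV; congr bigop.
by apply/funext => x; rewrite pcV.
Qed.

Definition ev w : cox N := \prod_(i <- w) refl i.

Lemma ev_cat u v : ev (u ++ v) = ev u * ev v.
Proof. exact: big_cat. Qed.

Lemma ev_cons i w : ev (i :: w) = refl i * ev w.
Proof. exact: big_cons. Qed.

Lemma ev_rcons w i : ev (rcons w i) = ev w * refl i.
Proof. by rewrite -cats1 ev_cat ev_cons [ev [::]]big_nil mulg1. Qed.

Lemma cword_ev w : cword (ev w) = cmulw w [::].
Proof.
elim: w => [|i w IHw]; first by rewrite /ev big_nil.
by rewrite /ev big_cons -/(ev w) /= IHw.
Qed.

Lemma size_ev w : (size (ev w) <= size w)%N.
Proof.
rewrite cword_ev; elim: w => //= i w; case: (cmulw w [::]) => //= j w' h.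
by case: ifP => _ /=; rewrite ?ltnS // (leq_trans _ (leqW h)).
Qed.

Lemma ev_cword (x : cox N) : ev (cword x) = x.
Proof. by apply/val_inj; rewrite /= cword_ev cmulw0 ?cword_alternating. Qed.

Lemma ev_rev w : ev (rev w) = (ev w)^-1.
Proof.
rewrite /ev -[w in RHS]revK -prodgV; congr bigop; apply/funext => i.
by rewrite reflV.
Qed.

Lemma alternating_overlap w i u :
  alternating (rcons w i) -> alternating (i :: u) -> alternating (rcons w i ++ u).
Proof.
case: w => [|j w] //=; rewrite /alternating /= => a1 a2.
by rewrite cat_path a1 last_rcons.
Qed.

Section Reduced.
Variables (f : aut (cox N)) (w : 'I_N -> seq 'I_N) (c : 'I_N -> 'I_N).
Hypothesis fE : forall i, cword (f (refl i)) = w i ++ c i :: rev (w i).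
Let stem i := rcons (w i) (c i).

(** If [w i] is [rcons (w j) (c j)] followed by [v], conjugation by [f (refl j)] cancels the letter
    [c j] on both sides of the palindrome. *)
Lemma stem_prefix_size i j : i != j -> prefix (stem j) (stem i) ->
  (size (f (refl j) * f (refl i) * f (refl j))%g < size (f (refl i)))%N.
Proof.
move=> ij /prefixP[v]; case/lastP: v => [|v k].
  (* Equal stems would give equal images, against the injectivity of [f]. *)
  rewrite cats0 /stem => /rcons_inj[wE cE]; case/eqP: ij.
  apply/(@refl_inj N)/(can_inj (aut_funK f))/val_inj.
  by rewrite /= fE (fE j) wE cE.
rewrite /stem -rcons_cat => /rcons_inj[wE cE].
have fev m : f (refl m) = ev (w m) * refl (c m) * (ev (w m))^-1.
  by rewrite -[LHS]ev_cword fE ev_cat ev_cons ev_rev !mulgA.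
set x := _ * f (refl j).
have -> : x = ev ((w j ++ v) ++ c i :: rev (w j ++ v)).
  rewrite ev_cat ev_cons ev_rev !ev_cat /x (fev i) (fev j) wE !ev_cat ev_rcons.
  by rewrite !invgM !reflV !mulgA !mulgVK !mulRK.
apply: leq_ltn_trans (size_ev _) _.
by rewrite fE wE !size_cat /= !size_rev !size_cat size_rcons; lia.
Qed.

Hypothesis stem_free : forall i j, i != j -> ~~ prefix (stem j) (stem i).

(* If no stem is a prefix of another one, then in a product of the images
   [f (refl i)] no cancellation reaches the middle letters [c i]. *)
Lemma stem_prefix i u (aiu : alternating (i :: u)) :
  prefix (stem i) (cword (f (Cox aiu))).
Proof.
have a_stem k : alternating (stem k).
  have := cword_alternating (f (refl k)); rewrite fE -cat_rcons.
  by case/cat_sorted2.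
elim: u => [|k u IHu] in i aiu *.
  have -> : Cox aiu = refl i by apply/val_inj.
  by rewrite fE -cat_rcons prefix_prefix.
rewrite cox_cons aut_morph /= fE -cat_rcons /cmulw foldr_cat -!/(cmulw _ _).
set v := cword (f _); set z := cmulw (rev _) v.
have av : alternating v by apply: cword_alternating.
have az : alternating z by apply: cmulw_alternating.
have vE : v = cmulw (w i) z by rewrite -{1}(revK (w i)) cmulVw.
have pv : prefix (stem k) v by apply: IHu.
have ik : i != k by case/andP: (aiu).
have aiz : alternating (c i :: z).
  move: az vE; rewrite /alternating; case: z => //= j z az vE.
  rewrite az andbT; apply/eqP => cj; rewrite -cj in az vE.
  have vE' : v = stem i ++ z.
    have a2 : alternating (stem i ++ z) by exact: alternating_overlap (a_stem i) az.
    by rewrite vE cmulw_cat -?cat_rcons.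
  have [s1|/ltnW s1] := leqP (size (stem k)) (size (stem i)).
    case/negP: (stem_free ik).
    by move: pv; rewrite !prefixE vE' takel_cat.
  have ki : k != i by rewrite eq_sym.
  case/negP: (stem_free ki); case/prefixP: pv => v' vE2.
  by rewrite prefixE -(takel_cat v' s1) -vE2 vE' take_size_cat.
by rewrite cmulw_cat ?prefix_prefix //; apply: alternating_overlap (a_stem i) aiz.
Qed.

(** Each [refl m] is the image of a nonempty word, and the stem of its first letter is a prefix of
    the single letter [m]; so this first letter already has image [refl m]. The choice of these
    letters is injective, hence bijective. *)
Lemma reduced_permutes : exists s : 'I_N -> 'I_N,
  forall i, f (refl i) = refl (s i).
Proof.
have ex m : exists i, f (refl i) = refl m.
  have [x fx] : exists x, f x = refl m.
    by exists (aut_inv f (refl m)); rewrite aut_invK.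
  case: x fx => -[|i u] ax fx.
    have x1 : Cox ax = 1 by apply/val_inj.
    by move: fx; rewrite x1 aut_one => /(congr1 (@cword N)).
  exists i; have := stem_prefix ax; rewrite fx /stem.
  have := fE i; case: (w i) => [|j wi] fi; last first.
    by case: wi {fi} => [|? ?]; rewrite /= andbF.
  case/andP=> /eqP cm _.
  by apply/val_inj; rewrite /= fi cm.
have [g fg] := choice ex.
have gI : injective g.
  by move=> m m' gm; apply: (@refl_inj N); rewrite -(fg m) gm fg.
have [g' _ gg'] := injF_bij gI.
by exists g' => i; rewrite -{1}(gg' i) fg.
Qed.

End Reduced.

(** Induction on the total length of the images of the generators: while some stem is a prefix of
    another one, a partial conjugation shortens one image and keeps the others. *)
Lemma pc_reduction f : exists r, off_diag r /\ exists s : 'I_N -> 'I_N,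
  forall i, (f * pc_seq r) (refl i) = refl (s i).
Proof.
have [m] := ubnP (\sum_i size (f (refl i)))%N.
elim: m f => // m IHm f fm.
have ex i : exists wc : seq 'I_N * 'I_N,
    cword (f (refl i)) = wc.1 ++ wc.2 :: rev wc.1.
  have [w [k E]] := involution_cword (aut_involution f i) (aut_refl_neq1 f i).
  by exists (w, k).
have [wc fE] := choice ex.
pose stem i := rcons (wc i).1 (wc i).2.
have [/existsP[i /existsP[j /andP[ij pre]]]|/existsPn nr] :=
  boolP [exists i, exists j, (i != j) && prefix (stem j) (stem i)]; last first.
  exists [::]; split=> //.
  have [i j ij|s fs] := @reduced_permutes f _ _ fE.
    by have /existsPn/(_ j) := nr i; rewrite ij.
  by exists s => i; rewrite /pc_seq big_nil mulg1.
have lt := stem_prefix_size fE ij pre.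
have [|r [rP [s frs]]] := IHm (f * pc i j).
  rewrite ltnS in fm; apply: leq_trans fm.
  rewrite (bigD1 i) // [X in (_ < X)%N](bigD1 i) //.
  rewrite autEM pc_eq !aut_morph -addSn leq_add // leq_sum // => k ki.
  by rewrite autEM pc_neq.
exists ((i, j) :: r); split; first by rewrite /off_diag /= ij.
by exists s => k; rewrite /pc_seq big_cons mulgA; apply: frs.
Qed.

End Nielsen.

(** * The free group as the even subgroup *)

Section FreeToCoxeter.
Variable n : nat.
Implicit Types (i k : 'I_n) (u v : free n) (x : cox n.+1).

Lemma letter_exp_linv i (a : 'I_n * bool) :
  letter_exp i (linv a) = (- letter_exp i a)%R.
Proof.
by rewrite /letter_exp /=; case: ifP => _; rewrite ?oppr0 //; case: (a.2).
Qed.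

(** The inverse of the first letter occurs later in the word, and since all values commute the two
    cancel. *)
Lemma balanced_letters (Q : groupType) (L : 'I_n * bool -> Q)
    (w : seq ('I_n * bool)) :
    (forall a b, commute (L a) (L b)) ->
    (forall a, L (linv a) = (L a)^-1) ->
    (forall i, (\sum_(a <- w) letter_exp i a)%R = 0%R) ->
  \prod_(a <- w) L a = 1.
Proof.
move=> Lc LV; have [m] := ubnP (size w); elim: m w => // m IHm [|a w] wm w0.
  by rewrite big_nil.
have aw : linv a \in w.
  apply/negPn/negP => naw; have := w0 a.1; rewrite big_cons => s0.
  (* Without the inverse letter, all occurrences of this generator have the sign of [a], and the
     exponent sum cannot vanish. *)
  have : (0 <= (-1) ^+ a.2 * \sum_(b <- w) letter_exp a.1 b)%R.
    rewrite mulr_sumr big_seq; apply: sumr_ge0 => b bw.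
    rewrite /letter_exp; have [ba|_] := eqVneq b.1 a.1; last by rewrite mulr0.
    suff -> : b.2 = a.2 by case: (a.2).
    apply: contraNeq naw => b2; suff <- : b = linv a by [].
    by case: b a ba b2 {bw s0 w0 wm} => [bi be] [ai ae] /= ->; case: be; case: ae.
  move: s0; rewrite {1}/letter_exp eqxx.
  by move: (\sum_(b <- w) _)%R => s; clear; case: (a.2) => /=; lia.
case/splitPr: aw wm w0 => w1 w2 wm w0.
rewrite big_cons big_cat big_cons /= LV.
have -> : L a * (\prod_(b <- w1) L b * ((L a)^-1 * \prod_(b <- w2) L b)) =
    \prod_(b <- w1) L b * \prod_(b <- w2) L b.
  have cm : commute (L a) (\prod_(b <- w1) L b) by apply: commute_prod.
  by rewrite mulgA cm -mulgA mulVKg.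
rewrite -big_cat; apply: IHm.
  by move: wm; rewrite /= !size_cat /=; lia.
move=> i; apply: etrans (w0 i).
rewrite big_cons !big_cat big_cons /= letter_exp_linv.
by rewrite [in RHS](addrCA _ (- _)%R) addNKr.
Qed.

Lemma free_commuting_morph (Q : groupType) (f : free n -> Q) u :
    {morph f : x y / x * y} -> (forall i k, commute (f (gen i)) (f (gen k))) ->
    (forall i, expsum i u = 0%R) -> f u = 1.
Proof.
move=> fM fc u0.
have -> : f u = free_lift (f \o gen) u.
  by apply: free_morph_eq => // [|i]; [apply: free_liftM|rewrite free_lift_gen].
apply: balanced_letters => // [a b|a]; last exact: lift_linv.
rewrite /lift_letter /=; case: ifP => _; case: ifP => _ //.
- by apply/commute_sym/commuteV/commute_sym/commuteV.
- by apply/commute_sym/commuteV.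
- exact/commuteV.
Qed.

Definition f2c : free n -> cox n.+1 :=
  free_lift (fun i => refl ord0 * refl (lift ord0 i)).

Lemma f2cM : {morph f2c : x y / x * y}. Proof. exact: free_liftM. Qed.

Lemma f2c_gen i : f2c (gen i) = refl ord0 * refl (lift ord0 i).
Proof. exact: free_lift_gen. Qed.

Lemma f2c1 : f2c 1 = 1. Proof. exact: morph_one f2cM. Qed.

Lemma f2cV u : f2c u^-1 = (f2c u)^-1. Proof. exact: morph_inv f2cM _. Qed.

Lemma parity_f2c u : parity (f2c u) = false.
Proof.
elim/free_ind: u => [|i u IHu|i u IHu]; first by rewrite f2c1.
- by rewrite f2cM parityM IHu f2c_gen parityM !parity_refl.
- by rewrite f2cM f2cV parityM IHu parityV f2c_gen parityM !parity_refl.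
Qed.

Lemma f2c_iota u : f2c (iota n u) = refl ord0 * f2c u * refl ord0.
Proof.
pose g v := refl ord0 * f2c v * refl ord0.
apply: (free_morph_eq (f := fun v => f2c (iota n v)) (g := g)) => [x y|x y|i].
- by rewrite aut_morph f2cM.
- by rewrite /g f2cM !mulgA mulRK.
- by rewrite /g iota_gen f2cV f2c_gen invgM !reflV !mulgA refl2 mul1g.
Qed.

Lemma f2c_onto x :
  exists u, x = f2c u * (if parity x then refl ord0 else 1).
Proof.
elim/cox_ind: x => [|k x [u xE]]; first by exists 1; rewrite f2c1 mulg1.
pose z := if unlift ord0 k is Some i then gen i else 1 : free n.
have zE : refl k = refl ord0 * f2c z.
  rewrite /z; case: unliftP => [i ->|->]; last by rewrite f2c1 mulg1.
  by rewrite f2c_gen mulgA refl2 mul1g.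
exists (iota n (z * u)); rewrite parityM parity_refl f2c_iota f2cM zE {1}xE.
by case: (parity x); rewrite /= !mulgA ?mulg1 ?mulRK.
Qed.

Lemma f2c_even x : parity x = false -> exists u, x = f2c u.
Proof. by move=> px; have [u] := f2c_onto x; rewrite px mulg1; exists u. Qed.

(* The action of [cox n.+1] on [free n], identified with the cosets of the
   subgroup generated by [refl ord0]. *)
Definition c2f_step (k : 'I_n.+1) u : free n :=
  iota n (if unlift ord0 k is Some i then gen i * u else u).

Definition c2f x : free n := foldr c2f_step 1 (cword x).

Lemma iotaK : involutive (iota n). Proof. exact: iota_funK. Qed.

Lemma c2f_stepK (k : 'I_n.+1) : involutive (c2f_step k).
Proof.
move=> u; rewrite /c2f_step; case: (unlift ord0 k) => [i|]; last exact: iotaK.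
by rewrite aut_morph iotaK iota_gen mulKg.
Qed.

Lemma c2f_reflM (k : 'I_n.+1) x : c2f (refl k * x) = c2f_step k (c2f x).
Proof.
rewrite /c2f /=; case: (cword x) => [|l w] //=; case: eqP => [->|_] //.
by rewrite c2f_stepK.
Qed.

Lemma f2cK : cancel f2c c2f.
Proof.
move=> u; have c2f_gen i x : c2f (f2c (gen i) * x) = gen i * c2f x.
  rewrite f2c_gen -mulgA !c2f_reflM /c2f_step unlift_none liftK.
  exact: iotaK.
elim/free_ind: u => [|i u IHu|i u IHu]; first by rewrite f2c1.
- by rewrite f2cM c2f_gen IHu.
- apply: (@mulgI _ (gen i)).
  by rewrite -c2f_gen -f2cM !mulVKg.
Qed.

Lemma f2c_inj : injective f2c. Proof. exact: can_inj f2cK. Qed.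

Lemma c2fK x : parity x = false -> f2c (c2f x) = x.
Proof. by case/f2c_even=> u ->; rewrite f2cK. Qed.

(** An even element translates the line by an amount that depends only on its homology class; in
    this way the actions on the line detect homology. *)
Lemma alt_f2c phi u : alt phi (f2c u) =
  (\sum_i expsum i u * (phi ord0 - phi (lift ord0 i)))%R.
Proof.
have alt_gen i : alt phi (f2c (gen i)) = (phi ord0 - phi (lift ord0 i))%R.
  by rewrite f2c_gen alt_reflM alt_refl.
have sum_gen k :
    (\sum_i expsum i (gen k) * (phi ord0 - phi (lift ord0 i)))%R =
    (phi ord0 - phi (lift ord0 k))%R.
  rewrite (bigD1 k) //= expsum_gen eqxx mul1r big1 ?addr0 // => j /negPf jk.
  by rewrite expsum_gen jk mul0r.
elim/free_ind: u => [|k u IHu|k u IHu].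
- by rewrite f2c1 big1 // => i _; rewrite expsum1 mul0r.
- rewrite f2cM altM parity_f2c alt_gen IHu -sum_gen -big_split /=.
  by apply: eq_bigr => i _; rewrite expsumM mulrDl.
- rewrite f2cM altM f2cV parityV parity_f2c altV parity_f2c alt_gen IHu.
  rewrite -sum_gen -sumrN -big_split /=.
  by apply: eq_bigr => i _; rewrite expsumM expsumV mulrDl mulNr.
Qed.

Lemma expsum_of_alt u : (forall phi, alt phi (f2c u) = 0%R) ->
  forall i, expsum i u = 0%R.
Proof.
(* For the indicator of [lift ord0 i] only the coefficient of [i] survives, with a minus sign. *)
move=> u0 i; have := u0 (fun k : 'I_n.+1 => Posz (k == lift ord0 i)).
have nl j : (ord0 == lift ord0 j :> 'I_n.+1) = false.
  exact: negbTE (neq_lift ord0 j).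
rewrite alt_f2c (bigD1 i) // big1 => [|j ji].
  rewrite eqxx nl /= addr0.
  by move: (expsum i u); clear; lia.
by rewrite nl (inj_eq (@lift_inj _ _)) (negPf ji) subr0 mulr0.
Qed.

End FreeToCoxeter.

(** * Quotient groups *)

Section Subgroups.
Variable G : groupType.
Implicit Types (K S : set G) (x y : G).

Lemma subgroupM K x y : subgroup K -> K x -> K y -> K (x * y).
Proof.
by move=> [K1 Kd] Kx Ky; rewrite -[y]invgK -[y^-1]div1g; apply/Kd/Kd.
Qed.

Lemma subgroupV K x : subgroup K -> K x -> K x^-1.
Proof. by move=> [K1 Kd] Kx; rewrite -[x^-1]div1g; apply: Kd. Qed.

Lemma generated_subgroup S : subgroup (generated S).
Proof.
split=> [A [[A1 _] _] //|x y Sx Sy A [sA SA]].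
by apply: sA.2; [apply: Sx|apply: Sy].
Qed.

Lemma generated_sub S x : S x -> generated S x.
Proof. exact: sub_gen_smallest. Qed.

Lemma generated_ind S K : subgroup K -> (forall x, S x -> K x) ->
  forall x, generated S x -> K x.
Proof. by move=> sK SK; apply: smallest_sub. Qed.

Lemma generated_conj S : (forall x y, S x -> S (y * x * y^-1)) ->
  forall x y, generated S x -> generated S (y * x * y^-1).
Proof.
move=> SJ x y; apply: (@generated_ind S (fun x => generated S (y * x * y^-1))).
  split=> [|u v Su Sv]; first by rewrite mulg1 mulgV; case: (generated_subgroup S).
  have -> : y * (u / v) * y^-1 = y * u * y^-1 / (y * v * y^-1).
    by rewrite !invgM invgK !mulgA mulgVK.
  by have [_ Sd] := generated_subgroup S; apply: Sd.
move=> u Su; apply: generated_sub; exact: SJ.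
Qed.

End Subgroups.

Record normal_subgroup (G : groupType) := NormalSubgroup {
  nset : set G;
  nset_subgroup : subgroup nset;
  nset_conj : forall x y, nset x -> nset (y * x * y^-1) }.

Section QuotientGroup.
Variables (G : groupType) (K : normal_subgroup G).
Implicit Types x y z : G.

Lemma nset1 : nset K 1. Proof. exact: (nset_subgroup K).1. Qed.

Definition quo_eq : rel G := fun x y => `[< nset K (x / y) >].

Fact quo_eq_refl : reflexive quo_eq.
Proof. by move=> x; apply/asboolP; rewrite mulgV; apply: nset1. Qed.
Fact quo_eq_sym : symmetric quo_eq.
Proof.
suff sub x y : quo_eq x y -> quo_eq y x by move=> x y; apply/idP/idP; apply: sub.
move=> /asboolP Kxy; apply/asboolP; rewrite -invgF.
exact: subgroupV (nset_subgroup K) Kxy.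
Qed.
Fact quo_eq_trans : transitive quo_eq.
Proof.
move=> y x z /asboolP Kxy /asboolP Kyz; apply/asboolP.
by have := subgroupM (nset_subgroup K) Kxy Kyz; rewrite mulgA mulgVK.
Qed.
Canonical quo_equiv : equiv_rel G :=
  EquivRel quo_eq quo_eq_refl quo_eq_sym quo_eq_trans.

Definition quo : Type := {eq_quot quo_equiv}.
HB.instance Definition _ := Choice.on quo.
HB.instance Definition _ := EqQuotient.on quo.

Definition quo_mk x : quo := \pi_quo x.

Lemma quo_eqP x y : quo_mk x = quo_mk y <-> nset K (x / y).
Proof.
rewrite /quo_mk; split=> [/eqP|Kxy]; first by rewrite piE => /asboolP.
by apply/eqP; rewrite piE; apply/asboolP.
Qed.

Lemma quo_mk_repr (q : quo) : quo_mk (repr q) = q.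
Proof. by rewrite /quo_mk reprK. Qed.

Lemma repr_quo_mk x : nset K (repr (quo_mk x) / x).
Proof. by apply/quo_eqP; rewrite quo_mk_repr. Qed.

Definition quo_one : quo := quo_mk 1.
Definition quo_inv (u : quo) : quo := quo_mk (repr u)^-1.
Definition quo_mul (u v : quo) : quo := quo_mk (repr u * repr v).

Fact quo_mulE x y : quo_mul (quo_mk x) (quo_mk y) = quo_mk (x * y).
Proof.
apply/quo_eqP; have Kx := repr_quo_mk x; have Ky := repr_quo_mk y.
have := subgroupM (nset_subgroup K) (nset_conj (repr (quo_mk x)) Ky) Kx.
by rewrite !mulgA mulgVK invgM !mulgA.
Qed.

Fact quo_invE x : quo_inv (quo_mk x) = quo_mk x^-1.
Proof.
apply/quo_eqP; rewrite invgK.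
have := nset_conj x^-1 (subgroupV (nset_subgroup K) (repr_quo_mk x)).
rewrite invgF invgK !mulgA mulVg mul1g => Kx.
exact: Kx.
Qed.

Fact quo_mulA : associative quo_mul.
Proof.
move=> u v w; rewrite -(quo_mk_repr u) -(quo_mk_repr v) -(quo_mk_repr w).
by rewrite !quo_mulE mulgA.
Qed.
Fact quo_mul1 : left_id quo_one quo_mul.
Proof. by move=> u; rewrite -(quo_mk_repr u) quo_mulE mul1g. Qed.
Fact quo_1mul : right_id quo_one quo_mul.
Proof. by move=> u; rewrite -(quo_mk_repr u) quo_mulE mulg1. Qed.
Fact quo_mulV : left_inverse quo_one quo_inv quo_mul.
Proof. by move=> u; rewrite -(quo_mk_repr u) quo_invE quo_mulE mulVg. Qed.
Fact quo_Vmul : right_inverse quo_one quo_inv quo_mul.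
Proof. by move=> u; rewrite -(quo_mk_repr u) quo_invE quo_mulE mulgV. Qed.

HB.instance Definition _ := isGroup.Build quo
  quo_mulA quo_mul1 quo_1mul quo_mulV quo_Vmul.

Lemma quo_mkM : {morph quo_mk : x y / x * y}.
Proof. by move=> x y; rewrite -quo_mulE. Qed.

Lemma quo_mk1 : quo_mk 1 = 1. Proof. by []. Qed.

Lemma quo_mk_eq1 x : quo_mk x = 1 <-> nset K x.
Proof. by rewrite -quo_mk1 quo_eqP divg1. Qed.

Lemma quo_mk_prod (I : Type) (r : seq I) (P : pred I) (F : I -> G) :
  quo_mk (\prod_(i <- r | P i) F i) = \prod_(i <- r | P i) quo_mk (F i).
Proof. exact: (big_morph quo_mk quo_mkM quo_mk1). Qed.

End QuotientGroup.

(** * The Torelli group of the free product *)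

Section CoxeterTorelli.
Variable N : nat.
Implicit Types (f g h : aut (cox N)) (x u : cox N) (phi : 'I_N -> int).

(* [g] preserves, up to a translation of the line, the action of [cox N] in
   which [refl i] is the reflection in [phi i]. *)
Definition fixes phi g : Prop :=
  exists t : int, forall i, alt phi (g (refl i)) = (phi i + t)%R.

Lemma fixes_alt phi g : fixes phi g -> exists t : int, forall x,
  alt phi (g x) = (alt phi x + (if parity x then t else 0))%R.
Proof.
case=> t gt; exists t => x; rewrite alt_aut -alt_shift.
by congr (alt _ x); apply/funext.
Qed.

Lemma fixes_subgroup phi : subgroup (fixes phi).
Proof.
split=> [|g h [t gt] /fixes_alt[t' ht]].
  by exists 0%R => i; rewrite autE1 alt_refl addr0.
have hVt i : alt phi (h^-1 (refl i)) = (phi i - t')%R.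
  have := ht (h^-1 (refl i)); rewrite aut_parity parity_refl => E.
  have hK : h (h^-1 (refl i)) = refl i by rewrite -autEM mulgV autE1.
  by move: E; rewrite hK alt_refl => ->; rewrite addrK.
have [s gs] := fixes_alt (ex_intro _ t gt).
exists (s - t')%R => i; rewrite autEM gs aut_parity parity_refl hVt.
by rewrite addrAC addrA.
Qed.

(** The translation in [fixes] has no effect on even elements, and their alternating sums for all
    [phi] determine their homology classes: this is triviality on the homology of the even
    subgroup. *)
Definition cox_torelli : set (aut (cox N)) := [set g | forall phi, fixes phi g].

Lemma cox_torelli_subgroup : subgroup cox_torelli.
Proof.
split=> [phi|g h gT hT phi]; first by case: (fixes_subgroup phi).
by have [_] := fixes_subgroup phi; apply; [apply: gT|apply: hT].
Qed.

(** Composing the action for [phi] with [h] gives the action for another function [psi], to which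
    the hypothesis on [g] applies. *)
Lemma cox_torelli_conj g h : cox_torelli g -> cox_torelli (h * g * h^-1).
Proof.
move=> gT phi; pose psi i := alt phi (h (refl i)).
have [t gt] := fixes_alt (gT psi); exists t => i.
rewrite !autEM alt_aut -/psi gt aut_parity parity_refl -alt_aut.
by rewrite -autEM mulgV autE1 alt_refl.
Qed.

Lemma cox_torelli_inner u : parity u = false -> cox_torelli (inner u).
Proof.
move=> pu phi; exists (alt phi u + alt phi u)%R => i.
rewrite innerE !altM parityM pu parity_refl altV pu alt_refl /=.
by rewrite opprK addrAC addrC.
Qed.

Lemma cox_torelli_relator p j k l : j != p -> k != p -> l != p ->
  cox_torelli (pc_relator p j k l).
Proof.
move=> jp kp lp phi; exists 0%R => i; rewrite pc_relatorE // addr0.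
case: eqP => [->|_]; last exact: alt_refl.
rewrite !(altM, parityM, parity_refl, alt_refl) /=.
by lia.
Qed.

Definition cox_relation g : Prop :=
  (exists u, parity u = false /\ g = inner u) \/
  exists p j k l h, [/\ uniq [:: p; j; k; l] &
    g = h * pc_relator p j k l * h^-1].

Definition cox_kernel : set (aut (cox N)) := generated cox_relation.

Lemma cox_kernel_subgroup : subgroup cox_kernel.
Proof. exact: generated_subgroup. Qed.

Lemma cox_kernel_conj g h : cox_kernel g -> cox_kernel (h * g * h^-1).
Proof.
apply: generated_conj => {}g {}h [[u [pu ->]]|[p [j [k [l [f [U ->]]]]]]].
  by left; exists (h u); rewrite aut_parity inner_conj mulgK.
right; exists p, j, k, l, (h * f); split=> //.
by rewrite invgM !mulgA.
Qed.

Definition cox_normal := NormalSubgroup cox_kernel_subgroup cox_kernel_conj.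

Lemma cox_kernel_inner u : parity u = false -> cox_kernel (inner u).
Proof. by move=> pu; apply: generated_sub; left; exists u. Qed.

Lemma cox_kernel_relator p j k l : uniq [:: p; j; k; l] ->
  cox_kernel (pc_relator p j k l).
Proof.
move=> U; apply: generated_sub; right; exists p, j, k, l, 1; split=> //.
by rewrite invg1 mulg1 mul1g.
Qed.

Lemma cox_kernel_torelli g : cox_kernel g -> cox_torelli g.
Proof.
apply: generated_ind; first exact: cox_torelli_subgroup.
move=> {}g [[u [pu ->]]|[p [j [k [l [h [/= U ->]]]]]]].
  exact: cox_torelli_inner.
apply/cox_torelli_conj/cox_torelli_relator.
- by apply: contraTneq U => ->; rewrite !inE eqxx.
- by apply: contraTneq U => ->; rewrite !inE eqxx orbT.
- by apply: contraTneq U => ->; rewrite !inE eqxx !orbT.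
Qed.

End CoxeterTorelli.

(** * Adding one generator: extended automorphisms and conjugations of the last generator *)

Section Extension.
Variable m : nat.
Implicit Types (i j k l : 'I_m) (f g : aut (cox m)) (u v x : cox m).
Local Notation e := (@ord_max m).
Local Notation up i := (lift ord_max i : 'I_m.+1).

Definition emb : cox m -> cox m.+1 := cox_lift (fun i => refl (up i)).

Lemma embM : {morph emb : x y / x * y}.
Proof. by apply: cox_liftM => i; apply: refl2. Qed.

Lemma emb1 : emb 1 = 1. Proof. exact: morph_one embM. Qed.
Lemma embV x : emb x^-1 = (emb x)^-1. Proof. exact: morph_inv embM _. Qed.
Lemma emb_refl i : emb (refl i) = refl (up i).
Proof. exact: cox_lift_refl. Qed.

Lemma parity_emb x : parity (emb x) = parity x.
Proof.
elim/cox_ind: x => [|i x IHx]; first by rewrite emb1.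
by rewrite embM !parityM emb_refl !parity_refl IHx.
Qed.

Lemma alt_emb phi x : alt phi (emb x) = alt (fun i => phi (up i)) x.
Proof.
elim/cox_ind: x => [|i x IHx]; first by rewrite emb1 !alt1.
by rewrite embM emb_refl !alt_reflM IHx.
Qed.

Lemma cox_aut_eq_lift (f g : aut (cox m.+1)) :
  (forall i, f (refl (up i)) = g (refl (up i))) ->
  f (refl e) = g (refl e) -> f = g.
Proof.
by move=> fgi fge; apply: cox_aut_eq => k; case: (unliftP e k) => [i|] ->.
Qed.

Definition ext_fun f (k : 'I_m.+1) : cox m.+1 :=
  if unlift e k is Some i then emb (f (refl i)) else refl e.

Fact ext_fun2 f (k : 'I_m.+1) : ext_fun f k * ext_fun f k = 1.
Proof.
rewrite /ext_fun; case: (unlift e k) => [i|]; last exact: refl2.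
by rewrite -embM aut_involution emb1.
Qed.

Lemma ext_fun_emb f x : cox_lift (ext_fun f) (emb x) = emb (f x).
Proof.
have f2 := ext_fun2 f; elim/cox_ind: x => [|i x IHx].
  by rewrite aut_one emb1 (morph_one (cox_liftM f2)).
rewrite embM (cox_liftM f2) IHx aut_morph embM emb_refl cox_lift_refl.
by rewrite /ext_fun liftK.
Qed.

Fact ext_funK f (k : 'I_m.+1) : cox_lift (ext_fun f^-1) (ext_fun f k) = refl k.
Proof.
rewrite {2}/ext_fun; case: unliftP => [i ->|->].
  by rewrite ext_fun_emb -autEM mulVg autE1 emb_refl.
by rewrite cox_lift_refl /ext_fun unlift_none.
Qed.

Fact ext_funVK f (k : 'I_m.+1) : cox_lift (ext_fun f) (ext_fun f^-1 k) = refl k.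
Proof. by rewrite -{1}[f]invgK ext_funK. Qed.

Definition ext f : aut (cox m.+1) :=
  cox_aut (ext_fun2 f) (ext_fun2 f^-1) (ext_funVK f) (ext_funK f).

Lemma ext_emb f x : ext f (emb x) = emb (f x).
Proof. exact: ext_fun_emb. Qed.

Lemma ext_e f : ext f (refl e) = refl e.
Proof. by rewrite cox_autE /ext_fun unlift_none. Qed.

Lemma ext_inj f i : ext f (refl (up i)) = emb (f (refl i)).
Proof. by rewrite -emb_refl ext_emb. Qed.

Lemma extM : {morph ext : f g / f * g}.
Proof.
move=> f g; apply: cox_aut_eq_lift => [i|].
  by rewrite [RHS]autEM !ext_inj ext_emb autEM.
by rewrite [RHS]autEM !ext_e.
Qed.

Lemma ext1 : ext 1 = 1. Proof. exact: morph_one extM. Qed.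
Lemma extV f : ext f^-1 = (ext f)^-1. Proof. exact: morph_inv extM _. Qed.

Lemma lift_max_eq i j : (up i == up j) = (i == j).
Proof. exact: (inj_eq (@lift_inj _ _)). Qed.

Lemma lift_max_neq i : up i != e.
Proof. by rewrite eq_sym neq_lift. Qed.

Lemma ext_pc i j : ext (pc i j) = pc (up i) (up j).
Proof.
apply: cox_aut_eq_lift => [k|]; last first.
  by rewrite ext_e pc_neq // eq_sym lift_max_neq.
rewrite ext_inj; have [->|ki] := eqVneq k i.
  by rewrite !pc_eq !embM !emb_refl.
by rewrite !pc_neq ?lift_max_eq // emb_refl.
Qed.

Lemma ext_pc_relator p j k l :
  ext (pc_relator p j k l) = pc_relator (up p) (up j) (up k) (up l).
Proof. by rewrite /pc_relator !extM !ext_pc. Qed.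

(* Conjugating by [(emb u)^-1] rather than [emb u] makes [kappa] a morphism. *)
Definition kappa_fun u (k : 'I_m.+1) : cox m.+1 :=
  if k == e then (emb u)^-1 * refl e * emb u else refl k.

Fact kappa_fun2 u (k : 'I_m.+1) : kappa_fun u k * kappa_fun u k = 1.
Proof.
rewrite /kappa_fun; case: ifP => _; last exact: refl2.
by rewrite !mulgA mulgK mulRK mulVg.
Qed.

Lemma kappa_fun_emb u x : cox_lift (kappa_fun u) (emb x) = emb x.
Proof.
have u2 := kappa_fun2 u; elim/cox_ind: x => [|i x IHx].
  by rewrite emb1 (morph_one (cox_liftM u2)).
rewrite embM (cox_liftM u2) IHx emb_refl cox_lift_refl.
by rewrite /kappa_fun (negPf (lift_max_neq i)).
Qed.

Fact kappa_funK u (k : 'I_m.+1) :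
  cox_lift (kappa_fun u^-1) (kappa_fun u k) = refl k.
Proof.
have u2 := kappa_fun2 u^-1; rewrite {2}/kappa_fun; case: eqP => [->|/eqP ke].
  rewrite !(cox_liftM u2) -embV !kappa_fun_emb cox_lift_refl /kappa_fun eqxx.
  by rewrite !embV invgK !mulgA mulVg mul1g mulgVK.
by rewrite cox_lift_refl /kappa_fun (negPf ke).
Qed.

Fact kappa_funVK u (k : 'I_m.+1) :
  cox_lift (kappa_fun u) (kappa_fun u^-1 k) = refl k.
Proof. by rewrite -{1}[u]invgK kappa_funK. Qed.

Definition kappa u : aut (cox m.+1) :=
  cox_aut (kappa_fun2 u) (kappa_fun2 u^-1) (kappa_funVK u) (kappa_funK u).

Lemma kappa_emb u x : kappa u (emb x) = emb x.
Proof. exact: kappa_fun_emb. Qed.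

Lemma kappa_inj u i : kappa u (refl (up i)) = refl (up i).
Proof. by rewrite -emb_refl kappa_emb. Qed.

Lemma kappa_e u : kappa u (refl e) = (emb u)^-1 * refl e * emb u.
Proof. by rewrite cox_autE /kappa_fun eqxx. Qed.

Lemma kappaM : {morph kappa : u v / u * v}.
Proof.
move=> u v; apply: cox_aut_eq_lift => [i|]; first by rewrite autEM !kappa_inj.
rewrite autEM kappa_e (kappa_e v) !aut_morph autV_morph !kappa_emb kappa_e.
by rewrite embM invgM !mulgA.
Qed.

Lemma kappa1 : kappa 1 = 1. Proof. exact: morph_one kappaM. Qed.
Lemma kappaV u : kappa u^-1 = (kappa u)^-1. Proof. exact: morph_inv kappaM _. Qed.

Lemma ext_kappa f u : ext f * kappa u = kappa (f u) * ext f.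
Proof.
apply: cox_aut_eq_lift => [i|]; first by rewrite !autEM kappa_inj ext_inj kappa_emb.
by rewrite !autEM ext_e !kappa_e !aut_morph autV_morph ext_e !ext_emb.
Qed.

(** The inner automorphism by [emb u] also conjugates the last generator, which [kappa u]
    compensates. *)
Lemma ext_inner u : ext (inner u) = inner (emb u) * kappa u.
Proof.
apply: cox_aut_eq_lift => [i|].
  by rewrite autEM kappa_inj ext_inj !innerE !embM embV emb_refl.
by rewrite autEM kappa_e ext_e innerE !mulgA mulgV mul1g mulgK.
Qed.

Lemma kappa_twist i j : pc e (up i) * pc e (up j) = kappa (refl i * refl j).
Proof.
apply: cox_aut_eq_lift => [k|].
  by rewrite autEM kappa_inj !pc_neq // lift_max_neq.
rewrite autEM kappa_e pc_eq !aut_morph pc_eq !(pc_neq _ (lift_max_neq _)).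
by rewrite embM !emb_refl invgM !reflV !mulgA.
Qed.

(** Through this identity the relators make [kappa] commutative on even elements, see
    [kappa_balanced]. *)
Lemma kappa_relator j k l :
  pc_relator e (up j) (up k) (up l) =
  kappa (refl j * refl k * refl l * (refl j * refl k * refl l)).
Proof.
apply: cox_aut_eq_lift => [i|]; rewrite pc_relatorE ?lift_max_neq //.
  by rewrite (negPf (lift_max_neq i)) kappa_inj.
by rewrite eqxx kappa_e !embM !emb_refl !invgM !reflV !mulgA.
Qed.

End Extension.

(** * Peak reduction for jumping frogs *)

Section Hopping.
Variable I : finType.
Implicit Types (v : I -> int) (i j k l : I).

(* [v i] is the position of frog [i] on the line, and frog [i] jumps over frog
   [j] to the mirror image of its position. *)
Definition hop v i j : I -> int :=
  fun k => if k == i then (2 * v j - v i)%R else v k.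

(* The jumps of [i] over [j] which decrease [weight] (see [weight_hop]). *)
Definition descends v i j : bool :=
  ((0 < v j) && (v j < v i) || (v i < v j) && (v j <= 0))%R.

(** The extra one for negative positions breaks the tie between [t] and [-t]: a jump over a frog in
    0 from the negative side lowers the height. *)
Definition height (t : int) : nat := (`|t|.*2 + (t < 0)%R)%N.

Definition weight v : nat := (\sum_i height (v i))%N.

Lemma hop_neq v i j k : k != i -> hop v i j k = v k.
Proof. by rewrite /hop => /negPf->. Qed.

Lemma hop_eq v i j : hop v i j i = (2 * v j - v i)%R.
Proof. by rewrite /hop eqxx. Qed.

Lemma hopK v i j : i != j -> hop (hop v i j) i j = v.
Proof.
move=> ij; apply/funext => k; rewrite /hop eqxx [j == i]eq_sym (negPf ij).
by case: eqP => [->|]; lia.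
Qed.

Lemma descends_neq v i j : descends v i j -> i != j.
Proof. by apply: contraTneq => ->; rewrite /descends; lia. Qed.

Lemma weight_lt v v' i : (forall k, k != i -> v' k = v k) ->
  (height (v' i) < height (v i))%N -> (weight v' < weight v)%N.
Proof.
move=> vv' h; rewrite /weight (bigD1 i) //= [X in (_ < X)%N](bigD1 i) //=.
by rewrite (eq_bigr (fun k => height (v k))) ?ltn_add2r // => k /vv'->.
Qed.

Lemma weight_hop v i j : descends v i j -> (weight (hop v i j) < weight v)%N.
Proof.
move=> d; apply: (@weight_lt _ _ i) => [k|]; first exact: hop_neq.
by rewrite hop_eq; move: d; rewrite /descends /height; lia.
Qed.

Lemma hop_cases v i j : i != j ->
  [\/ v i = v j, descends v i j | descends (hop v i j) i j].
Proof.
move=> ij; have [->|vij] := eqVneq (v i) (v j); first by constructor 1.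
case d: (descends v i j); [by constructor 2|constructor 3].
move: d vij; rewrite /descends hop_eq hop_neq 1?eq_sym //; lia.
Qed.

Lemma descends_hop v i j k l : k != i -> l != i ->
  descends (hop v i j) k l = descends v k l.
Proof. by move=> ki li; rewrite /descends !hop_neq. Qed.

Lemma weight_hop_same v i k b : descends v i k -> descends v i b ->
    descends v b k ->
  (weight (hop (hop (hop v i k) b k) i b) < weight v)%N /\
  (weight (hop (hop (hop v i b) b k) i k) < weight v)%N.
Proof.
move=> dik dib dbk.
have ik := descends_neq dik; have ib := descends_neq dib.
have bk := descends_neq dbk; have kb : k != b by rewrite eq_sym.
have bi : b != i by rewrite eq_sym.
have ki : k != i by rewrite eq_sym.
(* Both routes reflect [b] in [k] and translate [i] by twice the vector from [b] to [k]; so it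
   remains to compare the height of [i]. *)
have low x : (forall m, m != i -> x m = hop v b k m) ->
    x i = (v i - 2 * v b + 2 * v k)%R -> (weight x < weight v)%N.
  move=> xm xi; apply: ltn_trans (weight_hop dbk); apply: (weight_lt xm).
  rewrite xi hop_neq //; move: dik dib dbk; rewrite /descends /height.
  by clear; lia.
split; apply: low => [m mi|].
- by rewrite /hop !(negPf mi, negPf bi, negPf ki).
- rewrite /hop !(negPf ib, negPf bi, negPf ki, negPf kb, eqxx).
  by clear; lia.
- by rewrite /hop !(negPf mi, negPf bi, negPf ki).
- rewrite /hop !(negPf ib, negPf bi, negPf ki, negPf kb, eqxx).
  by clear; lia.
Qed.

Lemma weight_hop_chain v k i j : descends v k i -> descends v i j -> k != j ->
  (weight (hop (hop v k i) k j) < weight v)%N /\ descends v k j.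
Proof.
move=> dki dij kj; have ki := descends_neq dki.
have ik : i != k by rewrite eq_sym.
have jk : j != k by rewrite eq_sym.
move: dki dij; rewrite /descends => dki dij; split; last by clear - dki dij; lia.
apply: (@weight_lt _ _ k) => [m mk|]; first by rewrite !hop_neq.
rewrite !hop_eq !hop_neq //; move: dki dij; rewrite /height.
by clear; lia.
Qed.

End Hopping.

(* [Q] is generated by the jumps [c i j]; right multiplication by [c i j] moves
   the frogs, whose positions relative to frog [o] are given by [y].  The frogs
   start with [e] in 1 and all others in 0, and the claim is that the elements
   of [Q] which fix this initial position lie in [S]. *)
Section Frogs.
Variables (I : finType) (o e : I) (Q : groupType) (c : I -> I -> Q).
Variables (S : set Q) (y : Q -> I -> int).
Implicit Types (f g s : Q) (v : I -> int) (i j k l m p q : I).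

Hypothesis c2 : forall i j, i != j -> c i j * c i j = 1.
Hypothesis c_comm : forall i j k l, i != j -> k != l ->
  i != k -> i != l -> k != j -> commute (c i j) (c k l).
Hypothesis c_block : forall i j k, i != j -> i != k -> j != k ->
  commute (c i j) (c i k * c j k).
Hypothesis c_rel : forall p j k l, p != j -> p != k -> p != l ->
  j != k -> j != l -> k != l ->
  c p j * c p k * c p l * (c p j * c p k * c p l) = 1.

Definition twist m j l := c m j * c m l.

Hypothesis c_inner : forall j l, j != l ->
  c l j * c j l = \prod_(m | (m != j) && (m != l)) twist m j l.

Hypothesis y_o : forall g, y g o = 0%R.
Hypothesis y_hop : forall g i j, i != o -> i != j ->
  y (g * c i j) = hop (y g) i j.

Hypothesis SM : forall f g, S f -> S g -> S (f * g).
Hypothesis S_hop : forall i j, i != j -> i != e -> j != e -> S (c i j).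
Hypothesis S_twist : forall i j, i != j -> i != e -> j != e -> S (twist e i j).
Hypothesis y_S : forall g, S g -> y g = fun k => Posz (k == e).

(** A derivation is a path of descents that ends in [S]. *)
Inductive reducible : Q -> Prop :=
| reducible0 g : S g -> reducible g
| reducibleS g i j :
    descends (y g) i j -> reducible (g * c i j) -> reducible g.

Definition stab v f := forall g, y g = v -> reducible g ->
  (y (g * f) = v /\ reducible (g * f)) /\
  (y (g * f^-1) = v /\ reducible (g * f^-1)).

Definition hops v := forall g, y g = v -> reducible g ->
  forall i j, i != o -> i != j -> reducible (g * c i j).

(* Two frogs in the same place can be exchanged for each other: jumping over one
   and then over the other does not move a frog, nor does jumping over the
   other one of the two. *)
Definition twists v := forall j l, j != l -> v j = v l ->
  (forall m, m != j -> m != l -> stab v (twist m j l)) /\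
  (j != o -> stab v (c j l)).

Lemma cK i j : i != j -> (c i j)^-1 = c i j.
Proof. by move=> ij; apply: (@mulgI _ (c i j)); rewrite mulgV c2. Qed.

Lemma mulcK g i j : i != j -> g * c i j * c i j = g.
Proof. by move=> ij; rewrite -mulgA c2 // mulg1. Qed.

Lemma twistV m j l : m != j -> m != l -> (twist m j l)^-1 = twist m l j.
Proof. by move=> mj ml; rewrite /twist invgM !cK. Qed.

Lemma stab1 v : stab v 1.
Proof. by move=> g yg Rg; rewrite invg1 mulg1. Qed.

Lemma stabV v f : stab v f -> stab v f^-1.
Proof. by move=> sf g yg Rg; have [] := sf g yg Rg; rewrite invgK. Qed.

Lemma stabM v f g : stab v f -> stab v g -> stab v (f * g).
Proof.
move=> sf sg h yh Rh; split.
  by have [[y1 R1] _] := sf h yh Rh; have [[]] := sg _ y1 R1; rewrite mulgA.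
have [_ [y1 R1]] := sg h yh Rh; have [_ []] := sf _ y1 R1.
by rewrite invgM mulgA.
Qed.

Lemma stab_prod v (K : Type) (r : seq K) (P : pred K) (F : K -> Q) :
  (forall x, P x -> stab v (F x)) -> stab v (\prod_(x <- r | P x) F x).
Proof.
by move=> sF; elim/big_ind: _ => [|f g sf sg|//]; [apply: stab1|apply: stabM].
Qed.

(** The element [f] can be tested at [v']: move there by [s], apply the conjugate of [f], and
    return. *)
Lemma stab_conj v v' s f :
  (forall g, y g = v -> reducible g -> y (g * s) = v' /\ reducible (g * s)) ->
  (forall g, y g = v' -> reducible g ->
     y (g * s^-1) = v /\ reducible (g * s^-1)) ->
  stab v' (s^-1 * f * s) -> stab v f.
Proof.
move=> sv sv' sf g yg Rg; have [y1 R1] := sv g yg Rg.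
have [[y2 R2] [y3 R3]] := sf _ y1 R1.
have [] := sv' _ y2 R2; have [] := sv' _ y3 R3.
have -> : g * s * (s^-1 * f * s)^-1 * s^-1 = g * f^-1.
  by rewrite !invgM invgK !mulgA !mulgK.
have -> : g * s * (s^-1 * f * s) * s^-1 = g * f by rewrite !mulgA !mulgK.
by [].
Qed.

Lemma descends_o g i j : descends (y g) i j -> i != o.
Proof. by apply: contraTneq => ->; rewrite /descends y_o; lia. Qed.

Lemma conj_commute p q f : p != q -> commute (c p q) f ->
  c p q * f * c p q = f.
Proof. by move=> pq ->; rewrite mulcK. Qed.

Lemma commute_twist p q m j l : p != q -> m != j -> m != l ->
  m != p -> m != q -> p != j -> p != l -> commute (c p q) (twist m j l).
Proof.
by move=> *; apply: commuteM; apply: c_comm; rewrite 1?eq_sym // eq_sym.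
Qed.

(** For distinct indices [c_rel] says that [c p q * twist p j l] is an involution; if [q] is [j] or
    [l], then [c2] suffices. *)
Lemma conj_twist_left p q j l : p != q -> p != j -> p != l -> j != l ->
  c p q * twist p j l * c p q = (twist p j l)^-1.
Proof.
move=> pq pj pl jl.
have [->|qj] := eqVneq q j; first by rewrite twistV // /twist !mulgA c2 // mul1g.
have [->|ql] := eqVneq q l; first by rewrite twistV // /twist !mulgA mulcK.
apply: (@mulIg _ (twist p j l)); rewrite mulVg -[RHS](@c_rel p q j l) //.
by rewrite /twist !mulgA.
Qed.

(** By [c_block], [c p q] commutes with [twist p j l * twist q j l]; as it inverts the first factor,
    its effect on the second one is determined. *)
Lemma conj_twist_right p q j l : p != q -> p != j -> p != l -> q != j ->
    q != l -> j != l ->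
  c p q * twist q j l * c p q = twist p j l * twist p j l * twist q j l.
Proof.
move=> pq pj pl qj ql jl.
have cpq : commute (c p q) (twist p j l * twist q j l).
  have -> : twist p j l * twist q j l = c p j * c q j * (c p l * c q l).
    rewrite /twist !mulgA -(mulgA (c p j)) (@c_comm p l q j) ?mulgA // eq_sym //.
  by apply: commuteM; apply: c_block.
set x := twist p j l in cpq *; set t := twist q j l in cpq *.
have ax : c p q * x^-1 * c p q = x.
  apply: invg_inj; rewrite (invgM _ (c p q)) (invgM (c p q)) invgK cK // mulgA.
  by rewrite conj_twist_left.
clearbody x t; have -> : x * x * t = c p q * x^-1 * c p q * (x * t).
  by rewrite ax mulgA.
by rewrite -{1}(mulKg x t) -!(mulgA (c p q)) -!(mulgA x^-1) cpq.
Qed.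

(** By [c_block], conjugation by [c j q * c l q] acts on [c m j] and [c m l] like conjugation by
    [c m q], which inverts the twist. *)
Lemma conj_pair_twist q m j l : q != j -> q != l -> m != j -> m != l ->
    m != q -> j != l ->
  (c j q * c l q)^-1 * twist m j l * (c j q * c l q) = (twist m j l)^-1.
Proof.
move=> qj ql mj ml mq jl; rewrite -(conj_twist_left mq) //.
have key i k : i != k -> q != i -> q != k -> m != i -> m != k ->
    (c i q * c k q)^-1 * c m i * (c i q * c k q) = c m q * c m i * c m q.
  move=> ik qi qk mi mk.
  have iq : i != q by rewrite eq_sym.
  have kq : k != q by rewrite eq_sym.
  have km : k != m by rewrite eq_sym.
  have h : c i q * c m i * c i q = c m q * c m i * c m q.
    apply: (@mulgI _ (c m q)); rewrite !mulgA c2 // mul1g.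
    by rewrite -(c_block mi) // !mulgA mulcK.
  have -> : (c i q * c k q)^-1 * c m i * (c i q * c k q) =
      c k q * (c i q * c m i * c i q) * c k q.
    by rewrite invgM !cK // !mulgA.
  have ki : k != i by rewrite eq_sym.
  have qm : q != m by rewrite eq_sym.
  rewrite h; apply: conj_commute => //.
  by apply: commuteM; [apply: commuteM|]; apply: c_comm.
have jq : j != q by rewrite eq_sym.
have lq : l != q by rewrite eq_sym.
have lj : l != j by rewrite eq_sym.
have -> : (c j q * c l q)^-1 * twist m j l * (c j q * c l q) =
  ((c j q * c l q)^-1 * c m j * (c j q * c l q)) * 
  ((c j q * c l q)^-1 * c m l * (c j q * c l q)).
  by rewrite /twist; move: (c j q * c l q) => z; rewrite !mulgA mulgK.
rewrite key // (c_comm jq lq) // key //.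
by rewrite /twist !mulgA mulcK.
Qed.

Lemma conj_pair q j l : q != j -> q != l -> j != l ->
  (c j q * c l q)^-1 * c j l * (c j q * c l q) = c j l.
Proof.
move=> qj ql jl; have jq : j != q by rewrite eq_sym.
by rewrite -mulgA (c_block jl) // 1?eq_sym // mulKg.
Qed.

(** Here [c j l] is [c p l] times the product [c p l * c j l], which commutes with [c p j]. *)
Lemma conj_coincide p j l : p != j -> p != l -> j != l ->
  c p j * c j l * c p j = twist p j l * twist p j l * c j l.
Proof.
move=> pj pl jl; have := c_block pj pl jl; rewrite /commute -mulgA => h.
rewrite -{1}(mulKg (c p l) (c j l)) cK // -!mulgA -h.
by rewrite /twist !mulgA.
Qed.

Lemma reducible_hop g i j : i != o -> i != j ->
  descends (y (g * c i j)) i j -> reducible g -> reducible (g * c i j).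
Proof. by move=> io ij d Rg; apply: (reducibleS d); rewrite mulcK. Qed.

(** * Inductive step at a position [v0], all lighter positions being settled *)

Section Step.
Variable v0 : I -> int.
Hypothesis IH : forall v, (weight v < weight v0)%N -> hops v /\ twists v.

Lemma lower_hop g i j : (weight (y g) < weight v0)%N -> reducible g ->
  i != o -> i != j -> reducible (g * c i j).
Proof. by move=> w Rg; have [h _] := IH w; apply: h. Qed.

Lemma raise_hop g i j : (weight (y (g * c i j)) < weight v0)%N ->
  i != o -> i != j -> reducible (g * c i j) -> reducible g.
Proof.
by move=> w io ij Rg; rewrite -(mulcK g ij); apply: lower_hop.
Qed.

Lemma lower_iff g i j : i != o -> i != j -> (weight (y g) < weight v0)%N ->
  (weight (hop (y g) i j) < weight v0)%N ->
  reducible g <-> reducible (g * c i j).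
Proof.
move=> io ij w w'; split=> [Rg|]; first exact: lower_hop.
by apply: raise_hop; rewrite ?y_hop.
Qed.

(** The two jumps commute and span a square whose other three corners are lighter than [v0]. *)
Lemma confluence_disjoint g i j k l : y g = v0 ->
  i != k -> i != l -> k != j ->
  descends v0 i j -> descends v0 k l -> reducible (g * c k l) ->
  reducible (g * c i j).
Proof.
move=> yg ik il kj dij dkl Rkl.
have ij := descends_neq dij; have kl := descends_neq dkl.
have io : i != o by apply: (@descends_o g _ j); rewrite yg.
have ko : k != o by apply: (@descends_o g _ l); rewrite yg.
have wij := weight_hop dij; have wkl := weight_hop dkl.
have yij : y (g * c i j) = hop v0 i j by rewrite y_hop // yg.
have dkl' : descends (hop v0 i j) k l.
  by move: dkl; rewrite /descends !hop_neq // eq_sym.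
apply: (@raise_hop _ k l) => //.
  by rewrite y_hop // yij; apply: ltn_trans wij; apply: weight_hop.
rewrite -mulgA -(c_comm kl ij) // 1?eq_sym // mulgA.
by apply: lower_hop => //; rewrite y_hop // yg.
Qed.

(* Both sides lead to [c i b * c b k * c i k = c i k * c b k * c i b]. *)
Lemma confluence_same g i k b : y g = v0 ->
  descends v0 i k -> descends v0 i b -> descends v0 b k ->
  reducible (g * c i k) <-> reducible (g * c i b).
Proof.
move=> yg dik dib dbk.
have ik := descends_neq dik; have ib := descends_neq dib.
have bk := descends_neq dbk.
have bi : b != i by rewrite eq_sym.
have ki : k != i by rewrite eq_sym.
have io : i != o by apply: (@descends_o g _ k); rewrite yg.
have bo : b != o by apply: (@descends_o g _ k); rewrite yg.
have wik := weight_hop dik; have wib := weight_hop dib.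
have [w1 w2] := weight_hop_same dik dib dbk.
have w3 : (weight (hop (hop v0 i k) b k) < weight v0)%N.
  by apply: ltn_trans wik; apply: weight_hop; rewrite descends_hop.
have w4 : (weight (hop (hop v0 i b) b k) < weight v0)%N.
  by apply: ltn_trans wib; apply: weight_hop; rewrite descends_hop.
have E : c i k * c b k * c i b = c i b * c b k * c i k.
  by rewrite -c_block // (c_comm ik bk) // mulgA.
apply: (iff_trans (@lower_iff _ b k _ _ _ _)); rewrite ?y_hop ?yg //.
apply: (iff_trans (@lower_iff _ i b _ _ _ _)); rewrite ?y_hop ?yg //.
apply: iff_sym.
apply: (iff_trans (@lower_iff _ b k _ _ _ _)); rewrite ?y_hop ?yg //.
apply: (iff_trans (@lower_iff _ i k _ _ _ _)); rewrite ?y_hop ?yg //.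
by rewrite -(mulgA g) -(mulgA g) -E !mulgA.
Qed.

(* Both sides lead to [c k i * c k j * c i j = c i j * c k j * c k i]. *)
Lemma confluence_chain g k i j : y g = v0 -> k != j ->
  descends v0 k i -> descends v0 i j ->
  reducible (g * c k i) <-> reducible (g * c i j).
Proof.
move=> yg kj dki dij.
have ki := descends_neq dki; have ij := descends_neq dij.
have ik : i != k by rewrite eq_sym.
have jk : j != k by rewrite eq_sym.
have ji : j != i by rewrite eq_sym.
have io : i != o by apply: (@descends_o g _ j); rewrite yg.
have ko : k != o by apply: (@descends_o g _ i); rewrite yg.
have wki := weight_hop dki; have wij := weight_hop dij.
have [w1 dkj] := weight_hop_chain dki dij kj.
have w2 : (weight (hop (hop (hop v0 k i) k j) i j) < weight v0)%N.
  by apply: ltn_trans w1; apply: weight_hop; rewrite !descends_hop.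
have w3 : (weight (hop (hop v0 i j) k j) < weight v0)%N.
  apply: ltn_trans wij; apply: weight_hop; rewrite descends_hop //.
have E : c k i * c k j * c i j = c i j * c k j * c k i.
  by rewrite -mulgA c_block // (c_comm kj ij).
have yE : y (g * c i j * c k j * c k i) = hop (hop (hop v0 k i) k j) i j.
  by rewrite -(mulgA g) -(mulgA g) -E !mulgA !y_hop ?yg.
apply: (iff_trans (@lower_iff _ k j _ _ _ _)); rewrite ?y_hop ?yg //.
apply: (iff_trans (@lower_iff _ i j _ _ _ _)); rewrite ?y_hop ?yg //.
apply: iff_sym.
apply: (iff_trans (@lower_iff _ k j _ _ _ _)); rewrite ?y_hop ?yg //.
apply: (iff_trans (@lower_iff _ k i _ _ _ _)); rewrite ?y_hop ?yg //.
  by move: yE; rewrite !y_hop ?yg // => ->.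
by rewrite -(mulgA g) -(mulgA g) -E !mulgA.
Qed.

Lemma S_ndescends g i j : S g -> descends (y g) i j = false.
Proof.
by move=> /y_S->; rewrite /descends; case: (i == e); case: (j == e).
Qed.

(** The path that reduces [g] may start with another descent; the two are joined by a path below
    [v0], found according to the frogs they share. *)
Lemma reducible_descends g i j : y g = v0 -> reducible g ->
  descends v0 i j -> reducible (g * c i j).
Proof.
move=> yg Rg dij; case: Rg yg => [{}g Sg yg|{}g k l dkl Rkl yg].
  by move: dij; rewrite -yg S_ndescends.
rewrite yg in dkl; have ij := descends_neq dij; have kl := descends_neq dkl.
have io : i != o by apply: (@descends_o g _ j); rewrite yg.
have ji : j != i by rewrite eq_sym.
have [ik|ik] := eqVneq i k.
  rewrite -ik in dkl kl Rkl *; have li : l != i by rewrite eq_sym.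
  have [->//|jl] := eqVneq j l.
  (* If [j] and [l] coincide, the two jumps differ by a twist, which stabilizes the lighter position
     by induction. *)
  have [vjl|vjl] := eqVneq (v0 j) (v0 l).
    have ygl : y (g * c i l) = hop v0 i l by rewrite y_hop ?yg.
    have [_ tw] := IH (weight_hop dkl).
    have [] := tw l j; rewrite 1?eq_sym // ?hop_neq // => sti _.
    have [[_]] := sti i kl ij _ ygl Rkl.
    by rewrite /twist mulgA mulcK.
  (* Both frogs lie between 0 and [i], so the outer one descends over the inner one. *)
  have [dlj|djl] : descends v0 l j \/ descends v0 j l.
    by move: dij dkl vjl; rewrite /descends; clear; lia.
  - exact/(confluence_same yg dij dkl dlj).
  - exact/(confluence_same yg dkl dij djl).
have [il|il] := eqVneq i l.
  rewrite -il in dkl Rkl; apply/(confluence_chain yg _ dkl dij) => //.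
  (* Two frogs cannot descend over each other. *)
  by apply: contraTneq dkl => ->; move: dij; rewrite /descends; clear; lia.
have [kj|kj] := eqVneq k j.
  rewrite kj in dkl Rkl; apply/(confluence_chain yg il dij dkl) => //.
exact: confluence_disjoint yg ik il kj dij dkl Rkl.
Qed.

Lemma stab_of_conj f i j : descends v0 i j ->
  stab (hop v0 i j) (c i j * f * c i j) -> stab v0 f.
Proof.
move=> dij sf; have ij := descends_neq dij.
have [io|io] := eqVneq i o.
  move=> g yg; move: dij; rewrite -yg => /descends_o.
  by rewrite io eqxx.
apply: (@stab_conj _ (hop v0 i j) (c i j)); rewrite ?cK //.
- move=> g yg Rg; rewrite y_hop ?yg //; split=> //.
  exact: reducible_descends.
- move=> g yg Rg; rewrite y_hop ?yg ?hopK //; split=> //.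
  apply: lower_hop => //; rewrite yg; exact: weight_hop.
Qed.

(** Both [j] and [l] jump over [q], so that they still coincide at the lighter position. *)
Lemma stab_of_conj_pair f j l q : v0 j = v0 l -> j != l -> descends v0 j q ->
  stab (hop (hop v0 j q) l q)
    ((c j q * c l q)^-1 * f * (c j q * c l q)) -> stab v0 f.
Proof.
move=> vjl jl djq sf; have jq := descends_neq djq.
have dlq : descends v0 l q by move: djq; rewrite /descends vjl.
have lq := descends_neq dlq; have lj : l != j by rewrite eq_sym.
have qj : q != j by rewrite eq_sym.
have ql : q != l by rewrite eq_sym.
have [jo|jo] := eqVneq j o.
  move=> g yg; move: djq; rewrite -yg => /descends_o.
  by rewrite jo eqxx.
have [lo|lo] := eqVneq l o.
  move=> g yg; move: dlq; rewrite -yg => /descends_o.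
  by rewrite lo eqxx.
have wj := weight_hop djq.
have djl : descends (hop v0 j q) l q by rewrite descends_hop.
have wl := ltn_trans (weight_hop djl) wj.
apply: (@stab_conj _ (hop (hop v0 j q) l q) (c j q * c l q)) => //.
- move=> g yg Rg; rewrite mulgA !y_hop ?yg //; split=> //.
  apply: lower_hop => //; first by rewrite y_hop ?yg.
  exact: reducible_descends.
- move=> g yg Rg; rewrite invgM !cK // mulgA !y_hop ?yg ?hopK //; split=> //.
  apply: lower_hop => //; first by rewrite y_hop ?yg ?hopK.
  by apply: lower_hop; rewrite ?yg.
Qed.

(** The descent of a third frog leaves [j] and [l] in place and conjugates the given element into a
    product of elements that stabilize the lighter position. *)
Lemma twists_single j l p q : j != l -> v0 j = v0 l -> descends v0 p q ->
    p != j -> p != l ->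
  (forall m, m != j -> m != l -> stab v0 (twist m j l)) /\
  (j != o -> stab v0 (c j l)).
Proof.
move=> jl vjl dpq pj pl; have pq := descends_neq dpq.
have [jp lp] : j != p /\ l != p by rewrite !(eq_sym _ p).
have [|tw tc] := (IH (weight_hop dpq)).2 j l jl; first by rewrite !hop_neq.
split=> [m mj ml|jo]; apply: (stab_of_conj dpq).
- have [->|mp] := eqVneq m p.
    by rewrite conj_twist_left //; apply/stabV/tw.
  have [E|mq] := eqVneq m q; last first.
    by rewrite conj_commute //; [apply: tw|apply: commute_twist].
  rewrite E in mj ml *; rewrite conj_twist_right //.
  by apply: stabM; [apply: stabM|]; apply: tw.
- have [E|qj] := eqVneq q j.
    rewrite E in tw tc *; rewrite conj_coincide //; apply: stabM; last exact: tc.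
    by apply: stabM; apply: tw.
  rewrite conj_commute //; first exact: tc.
  by apply: c_comm; rewrite // eq_sym.
Qed.

(** Letting [j] and [l] descend over [q] together settles all but the twist of [q] itself. *)
Lemma twists_pair j l q : j != l -> v0 j = v0 l -> descends v0 j q ->
  (forall m, m != j -> m != l -> stab v0 (twist m j l)) /\
  (j != o -> stab v0 (c j l)).
Proof.
move=> jl vjl djq; have jq := descends_neq djq.
have dlq : descends v0 l q by move: djq; rewrite /descends vjl.
have lq := descends_neq dlq; have lj : l != j by rewrite eq_sym.
have qj : q != j by rewrite eq_sym.
have ql : q != l by rewrite eq_sym.
have djl : descends (hop v0 j q) l q by rewrite descends_hop.
have wl := ltn_trans (weight_hop djl) (weight_hop djq).
have [|tw tc] := (IH wl).2 j l jl.
  by rewrite hop_neq // !hop_eq !hop_neq // vjl.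
have [|_ tc'] := (IH wl).2 l j lj.
  by rewrite [RHS]hop_neq // !hop_eq !hop_neq // vjl.
have sjl : j != o -> stab v0 (c j l).
  move=> jo; apply: (stab_of_conj_pair vjl jl djq).
  by rewrite conj_pair //; apply: tc.
have slj : l != o -> stab v0 (c l j).
  move=> lo; apply: (stab_of_conj_pair vjl jl djq).
  by rewrite (c_comm jq lq) // conj_pair //; apply: tc'.
have sm m : m != j -> m != l -> m != q -> stab v0 (twist m j l).
  move=> mj ml mq; apply: (stab_of_conj_pair vjl jl djq).
  by rewrite conj_pair_twist //; apply/stabV/tw.
split=> // m mj ml; have [->{m mj ml}|] := eqVneq m q; last exact: sm.
(* If [v0 o] is not 0, then [v0] is not the position of any [g]. *)
have [vo|vo] := eqVneq (v0 o) 0%R; last first.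
  by move=> g yg; case/eqP: vo; rewrite -yg y_o.
have jo : j != o by apply: contraTneq djq => ->; rewrite /descends vo; clear; lia.
have lo : l != o by apply: contraTneq dlq => ->; rewrite /descends vo; clear; lia.
(* The relation [c_inner] expresses the twist of [q] by the other ones. *)
have := c_inner jl; set r := index_enum I.
have rq : q \in r by apply: mem_index_enum.
case/splitPr: rq (index_enum_uniq I : uniq r) => r1 r2.
rewrite cat_uniq /= negb_or => /and3P[_ /andP[q1 _] /andP[q2 _]].
rewrite big_cat big_cons /= qj ql /=.
set A := \prod_(m <- r1 | _) _; set B := \prod_(m <- r2 | _) _ => E.
have sA : stab v0 A.
  rewrite /A big_seq_cond; apply: stab_prod => m /and3P[m1 mj ml].
  by apply: sm => //; apply: contraNneq q1 => <-.
have sB : stab v0 B.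
  rewrite /B big_seq_cond; apply: stab_prod => m /and3P[m1 mj ml].
  by apply: sm => //; apply: contraNneq q2 => <-.
have -> : twist q j l = A^-1 * (c l j * c j l) * B^-1.
  by rewrite E mulKg mulgK.
apply: stabM; last exact: stabV.
by apply: stabM; [apply: stabV|apply: stabM; [apply: slj|apply: sjl]].
Qed.

(** Without descents the reducible elements at [v0] lie in [S], so [v0] is the initial position or
    the claim is vacuous. There [e] stands alone, hence differs from [j] and [l]. *)
Lemma twists_ndescends j l : (forall p q, ~~ descends v0 p q) ->
  j != l -> v0 j = v0 l ->
  (forall m, m != j -> m != l -> stab v0 (twist m j l)) /\
  (j != o -> stab v0 (c j l)).
Proof.
move=> nd jl vjl; have lj : l != j by rewrite eq_sym.
have sS f : S f -> S f^-1 -> stab v0 f.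
  move=> Sf SVf g yg Rg; case: Rg yg => [{}g Sg|{}g k i + _] yg; last first.
    by rewrite yg (negPf (nd _ _)).
  have y1 h : S h -> y h = v0 by move=> Sh; rewrite -yg !y_S.
  by do !split; do ?apply: reducible0; do ?apply: y1; apply: SM.
have [v0e|v0e] := pselect (v0 = fun k => Posz (k == e)); last first.
  split=> [m _ _|_] g yg Rg; case: Rg yg => [{}g Sg|{}g k i + _] yg;
    by [case: v0e; rewrite -yg y_S | rewrite yg (negPf (nd _ _))].
have [je le] : j != e /\ l != e.
  move: vjl jl; rewrite v0e; case: eqP => [->|_]; case: eqP => [->|_] //.
  by rewrite eqxx.
split=> [m mj ml|_]; last by apply: sS; rewrite ?cK //; apply: S_hop.
have [E|me] := eqVneq m e.
  rewrite E in mj ml *; apply: sS; rewrite ?twistV //; exact: S_twist.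
by apply: sS; rewrite ?twistV //; apply: SM; apply: S_hop.
Qed.

Lemma hops_and_twists : hops v0 /\ twists v0.
Proof.
have tw0 : twists v0.
  move=> j l jl vjl.
  have [[p [q dpq]]|nd] := pselect (exists p q, descends v0 p q); last first.
    apply: twists_ndescends => // p q; apply/negP => dpq.
    by apply: nd; exists p, q.
  have [E|pj] := eqVneq p j; first by rewrite E in dpq; apply: twists_pair dpq.
  have [E|pl] := eqVneq p l; last exact: twists_single dpq pj pl.
  rewrite E in dpq; have lj : l != j by rewrite eq_sym.
  have djq : descends v0 j q by move: dpq; rewrite /descends vjl.
  exact: twists_pair djq.
split=> // g yg Rg i j io ij; have [vij|dij|dij] := hop_cases v0 ij.
- by have [_ /(_ io)] := tw0 i j ij vij => /(_ g yg Rg)[[]].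
- exact: reducible_descends.
- by apply: reducible_hop; rewrite ?y_hop ?yg.
Qed.

End Step.

Lemma reducibleM g i j : i != o -> i != j -> reducible g ->
  reducible (g * c i j).
Proof.
move=> io ij Rg; suff main v : hops v /\ twists v by apply: (main (y g)).1.
have [w] := ubnP (weight v); elim: w v => // w IHw v vw.
by apply: hops_and_twists => v' v'v; apply: IHw; apply: leq_trans v'v _.
Qed.

Hypothesis c_o : forall j, j != o -> exists r : seq (I * I),
  all [pred x | (x.1 != o) && (x.1 != x.2)] r /\
  c o j = \prod_(x <- r) c x.1 x.2.

(** Jumps preserve reducibility, those of frog [o] being rewritten by [c_o]; and as no frog can
    descend in the initial position, a reducible element there lies in [S]. *)
Lemma frog_stabilizer (r : seq (I * I)) :
  all [pred x | x.1 != x.2] r -> S 1 ->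
  y (\prod_(x <- r) c x.1 x.2) = (fun k => Posz (k == e)) ->
  S (\prod_(x <- r) c x.1 x.2).
Proof.
move=> rP S1 yr.
have Rprod g (s : seq (I * I)) : reducible g ->
    all [pred x | (x.1 != o) && (x.1 != x.2)] s ->
    reducible (g * \prod_(x <- s) c x.1 x.2).
  elim: s g => [|[i j] s IHs] g Rg /=; first by rewrite big_nil mulg1.
  move=> /andP[/andP[/= io ij] sP].
  by rewrite big_cons mulgA; apply: IHs => //; apply: reducibleM.
have Rprod' g (s : seq (I * I)) : reducible g ->
    all [pred x | x.1 != x.2] s ->
    reducible (g * \prod_(x <- s) c x.1 x.2).
  elim: s g => [|[i j] s IHs] g Rg /=; first by rewrite big_nil mulg1.
  move=> /andP[/= ij sP].
  rewrite big_cons mulgA; apply: IHs => //=.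
  have [io|io] := eqVneq i o; last exact: reducibleM.
  rewrite io in ij *; have [|s' [s'P ->]] := @c_o j; first by rewrite eq_sym.
  exact: Rprod.
have := Rprod' 1 r (reducible0 S1) rP.
rewrite mul1g => Rr; case: Rr yr => // g i j.
by move=> + _ yg; rewrite yg /descends; case: (i == e); case: (j == e).
Qed.

End Frogs.

(** * The Torelli group is generated by the relators *)

Section Positions.
Variables (n : nat) (phi : 'I_n.+1 -> int).
Implicit Types (g h : aut (cox n.+1)) (i j k : 'I_n.+1).

(** Subtracting the point of [ord0] removes the translation allowed by [fixes]. *)
Definition pos g k : int := (alt phi (g (refl k)) - alt phi (g (refl ord0)))%R.

Lemma pos_o g : pos g ord0 = 0%R.
Proof. exact: subrr. Qed.

Lemma pos_fixes h g : fixes phi h -> pos (h * g) = pos g.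
Proof.
move=> /fixes_alt[t ht]; apply/funext => k; rewrite /pos !autEM !ht.
by rewrite !aut_parity !parity_refl /= opprD addrACA subrr addr0.
Qed.

Lemma alt_pc g i j : alt phi (g (pc i j (refl i))) =
  (2 * alt phi (g (refl j)) - alt phi (g (refl i)))%R.
Proof.
rewrite pc_eq !aut_morph !altM !parityM !aut_parity !parity_refl /=.
by lia.
Qed.

Lemma pos_hop g i j : i != ord0 -> i != j -> pos (g * pc i j) = hop (pos g) i j.
Proof.
move=> i0 ij; apply/funext => k; rewrite /hop /pos !autEM.
rewrite (pc_neq _ (_ : ord0 != i)) 1?eq_sym //.
have [->|ki] := eqVneq k i; last by rewrite pc_neq.
by rewrite alt_pc; lia.
Qed.

End Positions.

(** Modulo the relators the images under [kappa] of the free generators commute, so on even elements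
    [kappa] factors through homology. *)
Lemma kappa_balanced m (u : cox m.+1) : parity u = false ->
  (forall phi, alt phi u = 0%R) -> cox_kernel (kappa u).
Proof.
move=> /f2c_even[v ->] v0.
apply/(quo_mk_eq1 (cox_normal _)).
pose f w := quo_mk (cox_normal m.+2) (kappa (f2c w)).
apply: (@free_commuting_morph _ _ f) => [x y|i k|]; last exact: expsum_of_alt.
  by rewrite /f f2cM kappaM quo_mkM.
have [->//|ik] := eqVneq i k; rewrite /commute -!quo_mkM; apply/quo_eqP.
rewrite -!kappaM -kappaV -kappaM !f2c_gen.
set a := refl ord0; set b := refl (lift ord0 i); set c := refl (lift ord0 k).
(* The commutator is conjugate to the square of [b * a * c], which [kappa] sends to a relator. *)
have -> : a * b * (a * c) / (a * c * (a * b)) =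
    a * (b * a * c * (b * a * c)) * a^-1.
  by rewrite !invgM /a /b /c !reflV !mulgA.
rewrite kappaM kappaV kappaM; apply: cox_kernel_conj.
rewrite -kappa_relator; apply: cox_kernel_relator.
rewrite /= !inE !negb_or !lift_max_eq !(eq_sym (ord_max : 'I_m.+2)) !lift_max_neq /=.
by rewrite (inj_eq (@lift_inj _ _)) ik.
Qed.

(** * Induction on the number of generators *)

Section InductiveStep.
Variable m : nat.
Hypothesis IH : forall r : seq ('I_m.+1 * 'I_m.+1), off_diag r ->
  cox_torelli (pc_seq r) -> cox_kernel (pc_seq r).
Local Notation e := (@ord_max m.+1).
Local Notation K := (cox_normal m.+2).
Local Notation mk := (quo_mk K).
Let delta (k : 'I_m.+2) : int := Posz (k == e).

(** By [ext_kappa] these products are closed under multiplication. The first factor is kept as a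
    word since the induction hypothesis is about words. *)
Definition fixator : set (quo K) := [set q | exists r u,
  [/\ off_diag r, parity u = false & q = mk (ext (pc_seq r) * kappa u)]].

Lemma fixator1 : fixator 1.
Proof.
exists [::], 1; split=> //.
by rewrite /pc_seq big_nil ext1 kappa1 mulg1.
Qed.

Lemma fixatorM f g : fixator f -> fixator g -> fixator (f * g).
Proof.
move=> [r1 [u1 [d1 p1 ->]]] [r2 [u2 [d2 p2 ->]]].
exists (r1 ++ r2), ((pc_seq r2)^-1 u1 * u2); split; first exact: off_diag_cat.
  by rewrite parityM aut_parity p1 p2.
rewrite -quo_mkM pc_seq_cat extM kappaM; congr mk.
rewrite -!mulgA; congr (_ * _); rewrite !mulgA; congr (_ * _).
by rewrite ext_kappa -autEM mulgV autE1.
Qed.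

Lemma fixator_hop i j : i != j -> i != e -> j != e -> fixator (mk (pc i j)).
Proof.
case: (unliftP e i) => [i' ->|->]; last by rewrite eqxx.
case: (unliftP e j) => [j' ->|->]; last by rewrite eqxx.
rewrite lift_max_eq => ij _ _; exists [:: (i', j')], 1; split=> //.
  by rewrite /off_diag /= ij.
by rewrite /pc_seq big_seq1 ext_pc kappa1 mulg1.
Qed.

Lemma fixator_twist i j : i != j -> i != e -> j != e ->
  fixator (mk (pc e i) * mk (pc e j)).
Proof.
case: (unliftP e i) => [i' ->|->]; last by rewrite eqxx.
case: (unliftP e j) => [j' ->|->]; last by rewrite eqxx.
move=> _ _ _; exists [::], (refl i' * refl j'); split=> //.
  by rewrite parityM !parity_refl.
by rewrite -quo_mkM kappa_twist /pc_seq big_nil ext1 mul1g.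
Qed.

Let y (q : quo K) := pos delta (repr q).

Lemma y_mk g : y (mk g) = pos delta g.
Proof.
have /cox_kernel_torelli/(_ delta) := repr_quo_mk K g.
by move=> /(pos_fixes g); rewrite mulgVK.
Qed.

Lemma e_neq0 : (ord0 : 'I_m.+2) != e. Proof. by []. Qed.

Lemma pos_delta : pos delta 1 = delta.
Proof.
apply/funext => k; rewrite /pos !autE1 !alt_refl /delta (negPf e_neq0).
by rewrite subr0.
Qed.

(** All points but that of [e] are in 0, so words without [e] have alternating sum 0, and
    conjugating [e] by such an even word does not move its point. *)
Lemma y_fixator q : fixator q -> y q = delta.
Proof.
move=> [r [u [_ pu ->]]]; rewrite y_mk.
apply/funext => k; rewrite /pos !autEM.
have fx i : i != e -> alt delta (ext (pc_seq r) (kappa u (refl i))) = 0%R.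
  case: (unliftP e i) => [i' ->|->]; last by rewrite eqxx.
  move=> _; rewrite kappa_inj ext_inj alt_emb.
  elim/cox_ind: (_ (refl i')) => // i'' x IHx.
  by rewrite alt_reflM IHx /delta (negPf (lift_max_neq _)).
rewrite (fx ord0 e_neq0) subr0 /delta; have [->|ke] := eqVneq k e; last exact: fx.
rewrite kappa_e -embV !aut_morph !ext_emb ext_e.
have ad x : alt delta (emb x) = 0%R.
  rewrite alt_emb; elim/cox_ind: x => // i'' x IHx.
  by rewrite alt_reflM IHx /delta (negPf (lift_max_neq _)).
rewrite !altM !ad !parityM parity_emb aut_parity parityV pu parity_refl.
by rewrite alt_refl /delta eqxx.
Qed.

Lemma step_stabilizer r : off_diag r -> y (mk (pc_seq r)) = delta ->
  fixator (mk (pc_seq r)).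
Proof.
move=> rP; rewrite /pc_seq quo_mk_prod => yr.
apply: (@frog_stabilizer _ ord0 e _ (fun i j => mk (pc i j)) fixator y) => //.
- by move=> i j _; rewrite -quo_mkM pc2.
- by move=> i j k l _ _ ik il kj; rewrite /commute -!quo_mkM pc_comm.
- move=> i j k _ ik jk; rewrite -(quo_mkM K (pc i k)) /commute -!quo_mkM.
  by rewrite pc_block.
- move=> p j k l pj pk pl jk jl kl.
  apply: (@etrans _ _ (mk (pc_relator p j k l))); first by rewrite !quo_mkM.
  apply/quo_mk_eq1; apply: cox_kernel_relator.
  by rewrite /= !inE !negb_or pj pk pl jk jl kl.
- move=> j l jl; rewrite -quo_mkM pc_inner // quo_mkM.
  have -> : mk (inner (refl j * refl l)) = 1.
    by apply/quo_mk_eq1; apply: cox_kernel_inner; rewrite parityM !parity_refl.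
  by rewrite mul1g quo_mk_prod; apply: eq_bigr => k _; rewrite quo_mkM.
- by move=> q; apply: pos_o.
- by move=> q i j i0 ij; rewrite -(quo_mk_repr q) -quo_mkM !y_mk pos_hop.
- exact: fixatorM.
- exact: fixator_hop.
- exact: fixator_twist.
- exact: y_fixator.
- move=> j j0.
  exists ([seq (k, ord0) | k <- index_enum 'I_m.+2 & k != ord0] ++
    [seq (k, j) | k <- index_enum 'I_m.+2 & (k != ord0) && (k != j)]); split.
    rewrite all_cat !all_map; apply/andP; split; apply/allP => k.
      by rewrite mem_filter => /andP[] /= -> _.
    by rewrite mem_filter => /andP[] /= /andP[-> ->].
  rewrite big_cat !big_map !big_filter /= (pc_from_others j0) quo_mkM.
  have -> : mk (inner (refl j * refl ord0)) = 1.
    by apply/quo_mk_eq1; apply: cox_kernel_inner; rewrite parityM !parity_refl.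
  by rewrite mul1g quo_mkM !quo_mk_prod.
- exact: fixator1.
Qed.

(* The kernel of the smaller group extends to the kernel of the larger one up
   to conjugations of the last generator. *)
Lemma ext_cox_kernel (f : aut (cox m.+1)) : cox_kernel f ->
  exists u, parity u = false /\ mk (ext f) = mk (kappa u).
Proof.
move: f; apply: generated_ind.
  split=> [|f g [u [pu fu]] [v [pv gv]]].
    by exists 1; rewrite ext1 kappa1.
  exists (u * v^-1); rewrite parityM parityV pu pv; split=> //.
  rewrite extM extV kappaM kappaV !quo_mkM fu.
  by rewrite !(morph_inv (@quo_mkM _ K)) gv.
move=> f [[u [pu ->]]|[p [j [k [l [h [U ->]]]]]]].
  exists u; split=> //; rewrite ext_inner quo_mkM.
  have -> : mk (inner (emb u)) = 1.
    by apply/quo_mk_eq1; apply: cox_kernel_inner; rewrite parity_emb.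
  by rewrite mul1g.
exists 1; split=> //; rewrite kappa1 (extM (h * _)) (extM h) extV ext_pc_relator.
apply/quo_mk_eq1; apply: cox_kernel_conj; apply: cox_kernel_relator.
rewrite -[uniq _]/(uniq (map (lift ord_max) [:: p; j; k; l])).
by rewrite map_inj_uniq //; apply: lift_inj.
Qed.

Lemma ext_kappa_torelli (f : aut (cox m.+1)) u : parity u = false ->
  cox_torelli (ext f * kappa u) -> cox_torelli f.
Proof.
move=> pu fu phi.
pose psi k := if unlift e k is Some i then phi i else 0%R.
have psi_inj : (fun i => psi (lift ord_max i)) = phi.
  by apply/funext => i; rewrite /psi liftK.
have [t ft] := fu psi; exists t => i.
have := ft (lift ord_max i); rewrite autEM kappa_inj ext_inj alt_emb psi_inj => ->.
by rewrite /psi liftK.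
Qed.

(** The first generators are fixed, so the translation is 0, whereas the point of the last one moves
    by twice [alt phi u]. *)
Lemma kappa_torelli (u : cox m.+1) : parity u = false ->
  cox_torelli (kappa u) -> forall phi, alt phi u = 0%R.
Proof.
move=> pu uT phi.
pose psi k := if unlift e k is Some i then phi i else 0%R.
have psi_inj : (fun i => psi (lift ord_max i)) = phi.
  by apply/funext => i; rewrite /psi liftK.
have [t ut] := uT psi.
have t0 : t = 0%R.
  have := ut (lift ord_max ord0); rewrite kappa_inj alt_refl.
  by rewrite -[LHS]addr0 => /addrI.
have := ut e; rewrite kappa_e -embV !altM !parityM !parity_emb parityV pu.
rewrite parity_refl alt_refl !alt_emb psi_inj altV pu t0 /psi unlift_none /=.
by move: (alt phi u) => s; clear; lia.
Qed.

Lemma cox_torelli_step (r : seq ('I_m.+2 * 'I_m.+2)) : off_diag r ->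
  cox_torelli (pc_seq r) -> cox_kernel (pc_seq r).
Proof.
move=> rP rT; apply/(quo_mk_eq1 K).
have [|r' [u [r'P pu E]]] := step_stabilizer rP.
  by rewrite y_mk -[pc_seq r]mulg1 pos_fixes ?pos_delta //; apply: rT.
have Tr' : cox_torelli (ext (pc_seq r') * kappa u).
  have /(quo_eqP K)/cox_kernel_torelli T := esym E.
  by have := subgroupM (@cox_torelli_subgroup _) T rT; rewrite mulgVK.
have r'T := ext_kappa_torelli pu Tr'.
(* By induction the first factor reduces to a conjugation [kappa v] of the last generator, which is
   merged with [kappa u]. *)
have [v [pv Ev]] := ext_cox_kernel (IH r'P r'T).
rewrite E quo_mkM Ev -quo_mkM -kappaM; apply/quo_mk_eq1.
have pvu : parity (v * u) = false by rewrite parityM pv pu.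
apply: kappa_balanced => //; apply: kappa_torelli => //.
have /(quo_eqP K)/cox_kernel_torelli T :
    mk (kappa (v * u)) = mk (ext (pc_seq r') * kappa u).
  by rewrite kappaM !quo_mkM Ev.
by have := subgroupM (@cox_torelli_subgroup _) T Tr'; rewrite mulgVK.
Qed.

End InductiveStep.

Lemma cox_torelli_kernel n (r : seq ('I_n.+1 * 'I_n.+1)) : off_diag r ->
  cox_torelli (pc_seq r) -> cox_kernel (pc_seq r).
Proof.
elim: n r => [|n IHn] r rP; last exact: cox_torelli_step.
(* With a single generator there is no pair off the diagonal. *)
case: r rP => [|[i j] r]; last by rewrite /off_diag /= !ord1.
by move=> _ _; rewrite /pc_seq big_nil; apply: (cox_kernel_subgroup _).1.
Qed.

(** * Hyperelliptic automorphisms *)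

Section Restriction.
Variable n : nat.
Implicit Types (f g h : aut (cox n.+1)) (u v : free n).

Definition res_fun f u : free n := c2f (f (f2c u)).

Lemma f2c_res f u : f2c (res_fun f u) = f (f2c u).
Proof. by rewrite c2fK // aut_parity parity_f2c. Qed.

Fact res_morph f : {morph res_fun f : u v / u * v}.
Proof. by move=> u v; apply: f2c_inj; rewrite f2cM !f2c_res f2cM aut_morph. Qed.

Fact res_funK f : cancel (res_fun f) (res_fun f^-1).
Proof. by move=> u; apply: f2c_inj; rewrite !f2c_res -autEM mulVg. Qed.

Fact res_funVK f : cancel (res_fun f^-1) (res_fun f).
Proof. by move=> u; apply: f2c_inj; rewrite !f2c_res -autEM mulgV. Qed.

Definition res f : aut (free n) := Aut (@res_morph f) (@res_funK f) (@res_funVK f).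

Lemma f2c_resE f u : f2c (res f u) = f (f2c u).
Proof. exact: f2c_res. Qed.

Lemma resM : {morph res : f g / f * g}.
Proof.
by move=> f g; apply: autP => u; apply: f2c_inj; rewrite autEM !f2c_resE.
Qed.

Lemma resV f : res f^-1 = (res f)^-1. Proof. exact: morph_inv resM f. Qed.

Lemma res_inner_f2c v : res (inner (f2c v)) = inner v.
Proof.
by apply: autP => u; apply: f2c_inj; rewrite f2c_resE !innerE !f2cM f2cV.
Qed.

Lemma res_inner_refl0 : res (inner (refl ord0)) = iota n.
Proof.
by apply: autP => u; apply: f2c_inj; rewrite f2c_resE innerE reflV f2c_iota.
Qed.

(** Conjugation by [refl ord0] commutes with [f] up to conjugation by the even element
    [f (refl ord0) * refl ord0]. *)
Lemma res_hyperelliptic f : hyperelliptic (outer (res f)).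
Proof.
rewrite /hyperelliptic /commute -!outerM; apply/outer_eqP.
have [v vE] : exists v, f (refl ord0) * refl ord0 = f2c v.
  by apply: f2c_even; rewrite parityM aut_parity !parity_refl.
exists v; rewrite -res_inner_f2c -vE -res_inner_refl0 -!resM; congr res.
by rewrite inner_conj mulgA -innerM mulRK.
Qed.

End Restriction.

(** * Permutations of the generators *)

Section Relabelling.
Variables (N : nat) (s : 'I_N -> 'I_N).
Hypothesis sK : involutive s.
Implicit Types i j k : 'I_N.

Fact relabel_fun2 i : refl (s i) * refl (s i) = 1 :> cox N.
Proof. exact: refl2. Qed.

Fact relabel_funK i : cox_lift (fun i => refl (s i)) (refl (s i)) = refl i.
Proof. by rewrite cox_lift_refl sK. Qed.

Definition relabel : aut (cox N) :=
  cox_aut relabel_fun2 relabel_fun2 relabel_funK relabel_funK.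

Lemma relabelE i : relabel (refl i) = refl (s i).
Proof. exact: cox_autE. Qed.

Lemma relabel_pc i j : relabel * pc i j = pc (s i) (s j) * relabel.
Proof.
apply: cox_aut_eq => k; rewrite !autEM relabelE.
have [->|ki] := eqVneq k i; first by rewrite !pc_eq !aut_morph !relabelE.
by rewrite !pc_neq ?relabelE ?(inj_eq (inv_inj sK)).
Qed.

Lemma relabel_relator p j k l :
  relabel * pc_relator p j k l * relabel^-1 =
  pc_relator (s p) (s j) (s k) (s l).
Proof.
have cp i i' : relabel * pc i i' * relabel^-1 = pc (s i) (s i').
  by rewrite relabel_pc mulgK.
by rewrite /pc_relator -!cp !mulgA !mulgVK.
Qed.

End Relabelling.

(** * Lifting automorphisms of the free group to the free product *)

Section Lifting.
Variable n : nat.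

(** The lift sends [refl ord0] to [f2c w * refl ord0]; the first condition prescribes the
    conjugation by this element, the second makes it an involution. *)
Definition twisted (theta : aut (free n)) (w : free n) : Prop :=
  (forall u, theta (iota n u) = w * iota n (theta u) * w^-1) /\
  iota n w = w^-1.

Lemma twistedV theta w : twisted theta w -> twisted theta^-1 (theta^-1 w^-1).
Proof.
move=> [tw ww]; have tK u : theta (theta^-1 u) = u by rewrite -autEM mulgV.
have tI : injective theta by apply: can_inj (aut_funK theta).
split=> [u|]; apply: tI.
  rewrite !aut_morph !(autV_morph, tK) tw tK invgK.
  by rewrite !mulgA mulVg mul1g mulgVK.
by rewrite tw !(autV_morph, tK) ww !invgK mulgK.
Qed.

Section Lift.
Variables (theta : aut (free n)) (w : free n).
Hypothesis tw : twisted theta w.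

Definition lift_base : cox n.+1 := f2c w * refl ord0.

Definition lift_fun (k : 'I_n.+1) : cox n.+1 :=
  if unlift ord0 k is Some i then lift_base * f2c (theta (gen i))
  else lift_base.

Lemma lift_base_conj u : lift_base * f2c u * lift_base = f2c (w * iota n u * w^-1).
Proof.
by rewrite -tw.2 !f2cM !f2c_iota /lift_base !mulgA mulRK.
Qed.

Lemma lift_base2 : lift_base * lift_base = 1.
Proof.
by rewrite -{1}[lift_base]mulg1 -f2c1 lift_base_conj aut_one mulg1 mulgV f2c1.
Qed.

Lemma lift_fun2 k : lift_fun k * lift_fun k = 1.
Proof.
rewrite /lift_fun; case: (unlift ord0 k) => [i|]; last exact: lift_base2.
by rewrite mulgA lift_base_conj -tw.1 iota_gen -f2cM -aut_morph mulVg aut_one f2c1.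
Qed.

Lemma lift_fun_f2c u : cox_lift lift_fun (f2c u) = f2c (theta u).
Proof.
apply: (free_morph_eq (f := cox_lift lift_fun \o @f2c n) (g := @f2c n \o theta)).
- by move=> x y /=; rewrite f2cM (cox_liftM lift_fun2).
- by move=> x y; rewrite /= aut_morph f2cM.
move=> i; rewrite /= f2c_gen (cox_liftM lift_fun2) !cox_lift_refl /lift_fun.
by rewrite unlift_none liftK mulgA lift_base2 mul1g.
Qed.

End Lift.

Lemma lift_funK theta w theta' w' k : twisted theta w -> theta * theta' = 1 ->
  theta w' * w = 1 ->
  cox_lift (lift_fun theta w) (lift_fun theta' w' k) = refl k.
Proof.
move=> tw tt ww; have f2 := lift_fun2 tw.
have base : cox_lift (lift_fun theta w) (lift_base w') = refl ord0.
  rewrite (cox_liftM f2) lift_fun_f2c // cox_lift_refl /lift_fun unlift_none.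
  by rewrite /lift_base mulgA -f2cM ww f2c1 mul1g.
rewrite {2}/lift_fun; case: unliftP => [i ->|-> //].
rewrite (cox_liftM f2) base lift_fun_f2c // -autEM tt autE1 f2c_gen.
by rewrite mulgA refl2 mul1g.
Qed.

Lemma res_onto theta w : twisted theta w -> exists f : aut (cox n.+1),
  res f = theta.
Proof.
move=> tw; have tw' := twistedV tw.
set w' := theta^-1 w^-1 in tw'.
have fg k : cox_lift (lift_fun theta w) (lift_fun theta^-1 w' k) = refl k.
  by apply: lift_funK; rewrite ?mulgV // -autEM mulgV autE1 mulVg.
have gf k : cox_lift (lift_fun theta^-1 w') (lift_fun theta w k) = refl k.
  by apply: lift_funK; rewrite ?mulVg // -aut_morph mulgV aut_one.
exists (cox_aut (lift_fun2 tw) (lift_fun2 tw') fg gf).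
apply: autP => u; apply: f2c_inj; rewrite f2c_resE.
exact: lift_fun_f2c.
Qed.

End Lifting.

(** * The center of a free group of rank at least two *)

Section FreeCenter.
Variable n : nat.

Lemma mulw_cat (u v : seq ('I_n * bool)) : reduced (u ++ v) -> mulw u v = u ++ v.
Proof.
by elim: u => //= a u IHu auv; rewrite IHu ?pushE //; apply: reduced_cons auv.
Qed.

(** For a generator [k] other than that of the first letter [a] of [z], the word of [gen k * z]
    starts with [k], while that of [z * gen k] is shorter than [z] or starts with [a]. *)
Lemma free_center (z : free n) : (1 < n)%N ->
  (forall u, commute z u) -> z = 1.
Proof.
move=> n1 zc; apply/val_inj => /=.
case zE : (word z) => [//|a w]; exfalso.
have [k ka] : exists k : 'I_n, k != a.1.
  have [a0|a0] := eqVneq (val a.1) 0%N.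
    by exists (Ordinal n1); apply/eqP => /(congr1 val)/=; rewrite a0.
  by exists (Ordinal (ltnW n1)); apply: contraNneq a0 => <-.
have rz := word_reduced z.
have kz : word (gen k * z) = (k, false) :: word z.
  rewrite /= zE /=; case: eqP => // /(congr1 fst)/= E.
  by move: ka; rewrite E eqxx.
have zk : word (z * gen k) = (k, false) :: word z by rewrite -kz zc.
have [w' [c wE]] : exists w' c, word z = rcons w' c.
  by exists (belast a w), (last a w); rewrite zE lastI.
have [ck|ck] := eqVneq c (k, true).
  have rw' : reduced w' by move: rz; rewrite wE -cats1 => /cat_sorted2[].
  have zw : z * gen k = Free rw'.
    have -> : z = Free rw' * (gen k)^-1; last by rewrite mulgVK.
    apply/val_inj/esym; rewrite -[LHS]/(mulw w' [:: (k, true)]).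
    by rewrite mulw_cat cats1 -ck -wE.
  have := congr1 size zk; rewrite zw /= wE size_rcons; lia.
have rzk : reduced (word z ++ [:: (k, false)]).
  rewrite wE cats1 /reduced; move: rz; rewrite wE /reduced.
  have kc : (k, false) != linv c by apply: contraNneq ck => E; rewrite -[c]linvK -E.
  case: (w') => [|d w''] /=; first by rewrite kc.
  by rewrite !rcons_path last_rcons => /andP[-> ->] /=.
move: zk; rewrite /= mulw_cat // zE => -[E _].
by move: ka; rewrite E eqxx.
Qed.

End FreeCenter.

Lemma aut_conjE (G : groupType) (f g : aut G) x : (f * g * f^-1) (f x) = f (g x).
Proof. by rewrite !autEM -(autEM f^-1) mulVg. Qed.

(** * Excluding permutations of the generators *)

Section Purity.
Variable N : nat.
Implicit Types (f g : aut (cox N)) (r : seq ('I_N * 'I_N)).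

(** Reflecting a point in another one moves it by an even amount; so partial conjugations are
    invisible modulo 2, unlike permutations. *)
Lemma alt_pc_seq phi g r k : exists z : int,
  alt phi ((g * pc_seq r) (refl k)) = (alt phi (g (refl k)) + 2 * z)%R.
Proof.
elim: r g => [|[i j] r IHr] g.
  by exists 0%R; rewrite /pc_seq big_nil mulg1 mulr0 addr0.
rewrite /pc_seq big_cons mulgA -/(pc_seq r).
have [z ->] := IHr (g * pc i j); rewrite autEM.
have [->|ki] := eqVneq k i; last by exists z; rewrite pc_neq.
exists (z + alt phi (g (refl j)) - alt phi (g (refl i)))%R.
rewrite pc_eq !aut_morph !altM !parityM !aut_parity !parity_refl /=.
by move: (alt phi _) (alt phi _) => s t; clear; lia.
Qed.

End Purity.

Lemma cox_torelli_pc_seq n (f : aut (cox n.+3)) : cox_torelli f ->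
  exists r, off_diag r /\ f = pc_seq r.
Proof.
move=> fT; have [r [rP [s sE]]] := pc_reduction f.
have sI : injective s.
  move=> i j ij; apply: (@refl_inj n.+3).
  apply: (can_inj (aut_funK (f * pc_seq r))).
  by rewrite !sE ij.
have par (phi : 'I_n.+3 -> int) k l : exists z : int,
    (phi (s k) - phi (s l) = phi k - phi l + 2 * z)%R.
  have [t ft] := fT phi.
  have [z1] := alt_pc_seq phi f r k; have [z2] := alt_pc_seq phi f r l.
  rewrite !sE !alt_refl !ft => -> ->; exists (z1 - z2)%R.
  by move: (phi k) (phi l) => a b; clear; lia.
have s0 : s ord0 = ord0.
  apply/eqP/negPn/negP => s0.
  (* Modulo 2, the indicator of [ord0] forces [s] to send all other generators to [ord0]; there are
     at least two of them, against injectivity. *)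
  have bad k : k != ord0 -> s k = ord0.
    move=> k0; have [z] := par (fun i => Posz (i == ord0)) k ord0.
    rewrite (negPf k0) eqxx (negPf s0).
    by case: eqP => // _; clear; lia.
  pose i1 : 'I_n.+3 := lift ord0 ord0; pose i2 : 'I_n.+3 := ord_max.
  have : i1 = i2 by apply: sI; rewrite !bad.
  by move/(congr1 val).
have sid k : s k = k.
  apply/eqP/negPn/negP => sk; have [k0|k0] := eqVneq k ord0.
    by case/eqP: sk; rewrite k0.
  have [z] := par (fun i => Posz (i == k)) k ord0.
  by rewrite (negPf sk) eqxx s0 eq_sym (negPf k0); clear; lia.
exists (rev r); split; first by rewrite /off_diag all_rev.
have fr : f * pc_seq r = 1.
  by apply: cox_aut_eq => k; rewrite sE sid autE1.
apply: (@mulIg _ (pc_seq r)); rewrite fr -pc_seqV mulVg //.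
Qed.

(** * Transfer to the free group *)

Section Main.
Variable n : nat.

Lemma ST_subgroup : subgroup (ST n).
Proof.
split=> [|u v [hu tu] [hv tv]]; first split.
- by rewrite /HOut /centralizer /= /commute mulg1 mul1g.
- by rewrite /Torelli /kernel /=; apply: morph_one (@abel_outM n).
split.
  have hV : commute v^-1 (outer (iota n)) by apply/commute_sym/commuteV/commute_sym.
  by apply/commute_sym/commuteM; apply: commute_sym.
rewrite /Torelli /kernel /= abel_outM (morph_inv (@abel_outM n)).
by rewrite tu tv mulgV.
Qed.

Lemma Torelli_outer (theta : aut (free n)) :
  Torelli n (outer theta) <-> forall i j, expsum i (theta (gen j)) = (i == j)%:R%R.
Proof.
rewrite /Torelli /kernel /= abel_outE; split=> [/(congr1 val)/= /matrixP E i j|E].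
  by have := E i j; rewrite !mxE.
by apply/val_inj/matrixP => i j; rewrite !mxE E.
Qed.

(** Conjugation by [theta] reduces to the standard basis, where the transvection commutes with
    [iota n] itself and the commutators vanish in homology. *)
Lemma dct_ST (tau : aut (free n)) :
  doubled_commutator_transvection n tau -> ST n (outer tau).
Proof.
move=> [Y [[theta hth ->] [a [b [c [[]]]]]]].
move=> [_ [i _ <-] <-] [_ [j _ <-] <-] [_ [k _ <-] <-] [_ [tauc taux]].
pose w := commutator (gen i) (gen j).
pose sigma := theta^-1 * tau * theta.
have tK u : theta^-1 (theta u) = u by rewrite -autEM mulVg.
have thC x y : theta^-1 (commutator (theta x) (theta y)) = commutator x y.
  by rewrite /commutator !aut_morph !autV_morph !tK.
have sk : sigma (gen k) = w * gen k * commutator (gen j)^-1 (gen i)^-1.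
  rewrite /sigma !autEM tauc -!autV_morph (aut_morph _ (_ * theta (gen k))).
  by rewrite (aut_morph _ _ (theta (gen k))) !thC tK.
have sx m : m != k -> sigma (gen m) = gen m.
  move=> mk; rewrite /sigma !autEM taux ?tK //.
    by exists (gen m); [exists m|].
  move=> /(can_inj (aut_funK theta)) /(congr1 (@word n)) [] mk'.
  by case/eqP: mk.
have -> : outer tau = outer theta * outer sigma * (outer theta)^-1.
  by rewrite -outerV -!outerM /sigma !mulgA mulgV mul1g mulgK.
clearbody sigma.
have siota : sigma * iota n = iota n * sigma.
  apply/autP/free_morph_eq => [||m]; try exact: aut_morph.
  rewrite !autEM iota_gen autV_morph.
  have [->|mk] := eqVneq m k; last by rewrite sx // iota_gen.
  rewrite sk /commutator !(aut_morph, autV_morph, iota_gen).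
  by rewrite !invgM !invgK !mulgA.
split.
  have hs : commute (outer sigma) (outer (iota n)).
    by rewrite /commute -!outerM siota.
  have hV : commute (outer theta)^-1 (outer (iota n)).
    by apply/commute_sym/commuteV/commute_sym.
  by apply/commute_sym; do !apply: commuteM; apply: commute_sym.
have st : abel_out (outer sigma) = 1.
  apply/Torelli_outer => i' j'; have [->|jk] := eqVneq j' k; last first.
    by rewrite sx // expsum_gen.
  rewrite sk !expsumM !expsumV !expsum_gen.
  move: (i' == i)%:R%R (i' == j)%:R%R (i' == k)%:R%R; clear.
  by move=> p q r /=; lia.
rewrite /Torelli /kernel /= !abel_outM st (morph_inv (@abel_outM n)) mulg1.
exact: mulgV.
Qed.

Definition dct_generated : set (out (free n)) :=
  generated [set outer tau | tau in doubled_commutator_transvection n].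

(** Exchanging [k] and [ord0] puts [ord0] in the middle of the relator, which then restricts to a
    transvection of the standard basis; [res g] is hyperelliptic and carries it to the basis [Y]. *)
Lemma res_relator_dct (h : aut (cox n.+1)) p j k l : uniq [:: p; j; k; l] ->
  doubled_commutator_transvection n (res (h * pc_relator p j k l * h^-1)).
Proof.
move=> U.
pose s i := if i == k then ord0 else if i == ord0 then k else i.
have sK : involutive s.
  move=> i; rewrite /s; have [->|ik] := eqVneq i k.
    by rewrite eqxx; case: eqP.
  have [->|i0] := eqVneq i ord0; first by rewrite eqxx.
  by rewrite (negPf ik) (negPf i0).
pose t := relabel sK; pose g := h * t.
have sk : s k = ord0 by rewrite /s eqxx.
have E : h * pc_relator p j k l * h^-1 =
    g * pc_relator (s p) (s j) ord0 (s l) * g^-1.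
  have <- : t * pc_relator (s p) (s j) ord0 (s l) * t^-1 = pc_relator p j k l.
    by rewrite -sk relabel_relator !sK.
  by rewrite /g invgM; move: (pc_relator _ _ _ _) => x; rewrite !mulgA.
have U' : uniq [:: s p; s j; ord0; s l].
  rewrite -sk -[X in uniq X]/(map s [:: p; j; k; l]) map_inj_uniq //.
  exact: inv_inj.
rewrite {}E; move: U'; rewrite /= !inE !negb_or.
case: (unliftP ord0 (s p)) => [c ->|->]; last by rewrite eqxx andbF.
case: (unliftP ord0 (s j)) => [b ->|->]; last by rewrite eqxx !andbF.
case: (unliftP ord0 (s l)) => [a ->|->]; last by rewrite eqxx !andbF.
rewrite !(inj_eq (@lift_inj _ _)) => /and4P[/and3P[cb _ ca] /andP[_ ba] _ _].
have cb' : lift ord0 b != lift ord0 c :> 'I_n.+1.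
  by rewrite (inj_eq (@lift_inj _ _)) eq_sym.
have ca' : lift ord0 a != lift ord0 c :> 'I_n.+1.
  by rewrite (inj_eq (@lift_inj _ _)) eq_sym.
have c0 : ord0 != lift ord0 c :> 'I_n.+1 by apply: neq_lift.
pose rel := pc_relator (lift ord0 c) (lift ord0 b) ord0 (lift ord0 a).
have relc : res rel (gen c) =
    commutator (gen a) (gen b) * gen c * commutator (gen b)^-1 (gen a)^-1.
  apply: f2c_inj; rewrite f2c_resE f2c_gen aut_morph !pc_relatorE //.
  rewrite eqxx (negPf c0).
  rewrite /commutator !f2cM !f2cV !f2c_gen !invgM !reflV !mulgA !mulRK.
  by rewrite ?mulgA ?mulRK.
have relx i : i != c -> res rel (gen i) = gen i.
  move=> ic; apply: f2c_inj; rewrite f2c_resE f2c_gen aut_morph !pc_relatorE //.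
  by rewrite (inj_eq (@lift_inj _ _)) (negPf ic) (negPf c0).
have rg u : res (g * rel * g^-1) (res g u) = res g (res rel u).
  by rewrite (resM (g * rel)) (resM g) resV aut_conjE.
exists (res g @` basis n); split.
  by exists (res g) => //; apply: res_hyperelliptic.
exists (res g (gen a)), (res g (gen b)), (res g (gen c)).
have gin i : (res g @` basis n) (res g (gen i)) by exists (gen i) => //; exists i.
have gI i i' : i != i' -> res g (gen i) <> res g (gen i').
  move=> ii /(can_inj (aut_funK (res g))) /(congr1 (@word n)) [] ii'.
  by case/eqP: ii.
split; first by split; apply: gin.
split; first by split; apply: gI; rewrite // eq_sym.
split; first by rewrite rg relc /commutator !(aut_morph, autV_morph).
move=> _ [_ [i _ <-] <-] ic; rewrite rg relx //.
by apply: contra_notN ic => /eqP->.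
Qed.

Lemma cox_kernel_res (f : aut (cox n.+1)) : cox_kernel f ->
  dct_generated (outer (res f)).
Proof.
have sub : subgroup dct_generated by apply: generated_subgroup.
move: f; apply: generated_ind.
  split=> [|f g gf gg].
    by rewrite (morph_one (@resM n)) (morph_one (@outerM (free n))); case: sub.
  by rewrite resM resV outerM outerV; apply: sub.2.
move=> f [[u [/f2c_even[v ->] ->]]|[p [j [k [l [h [U ->]]]]]]].
  by rewrite res_inner_f2c outer_inner (morph_one (@outerM (free n))); case: sub.
apply: generated_sub; exists (res (h * pc_relator p j k l * h^-1)) => //.
exact: res_relator_dct.
Qed.

Lemma Torelli_expsum (theta : aut (free n)) i u :
  Torelli n (outer theta) -> expsum i (theta u) = expsum i u.
Proof.
move=> /Torelli_outer E; rewrite (expsum_morph _ _ (aut_morph theta)).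
rewrite (bigD1 i) //= E eqxx mul1r big1 ?addr0 // => j ji.
by rewrite E eq_sym (negPf ji) mul0r.
Qed.

(** In rank at most one the free group is commutative, so exponent sums determine its elements. *)
Lemma Torelli_small (theta : aut (free n)) : (n <= 1)%N ->
  Torelli n (outer theta) -> theta = 1.
Proof.
move=> n1 tT; apply: autP => u; rewrite autE1; apply: divg1_eq.
apply: (@free_commuting_morph _ _ id) => // [i k|i].
  suff -> : i = k by [].
  by apply/ord_inj; have := ltn_ord i; have := ltn_ord k; lia.
by rewrite expsumM expsumV Torelli_expsum // subrr.
Qed.

(** As [iota n] is an involution, commuting past it twice shows that [w * iota n w] is central,
    hence trivial. *)
Lemma HOut_twisted (theta : aut (free n)) : (1 < n)%N ->
  HOut n (outer theta) -> exists w, twisted theta w.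
Proof.
move=> n1; rewrite /HOut /centralizer /= /commute -!outerM.
move=> /outer_eqP[w E]; exists w.
have tw u : theta (iota n u) = w * iota n (theta u) * w^-1.
  by rewrite -innerE -!autEM E.
split=> //; apply: (@mulgI _ w); rewrite mulgV.
apply: free_center n1 _ => u; pose v := theta^-1 u.
have vE : theta v = u by rewrite /v -autEM mulgV.
have := tw (iota n v); rewrite iotaK tw vE !aut_morph autV_morph iotaK => uE.
by rewrite /commute {2}uE !mulgA !mulgVK.
Qed.

Lemma ST_dct_generated u : ST n u -> dct_generated u.
Proof.
have [theta ->] := outerP u; move=> [tH tT].
have sub : subgroup dct_generated by apply: generated_subgroup.
have [n1|n1] := leqP n 1.
  by rewrite (Torelli_small n1 tT) (morph_one (@outerM (free n))); case: sub.
have [w tw] := HOut_twisted n1 tH.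
have [f fE] := res_onto tw.
rewrite -fE; apply: cox_kernel_res.
have fT : cox_torelli f.
  (* The translation is the displacement of the point of [refl ord0]; the even factor [f2c (gen k)]
     keeps its alternating sum since [theta] is trivial on homology. *)
  move=> phi; exists (alt phi (f (refl ord0)) - phi ord0)%R => i.
  case: (unliftP ord0 i) => [k ->|->]; last by rewrite addrC subrK.
  have -> : refl (lift ord0 k) = refl ord0 * f2c (gen k) :> cox n.+1.
    by rewrite f2c_gen mulgA refl2 mul1g.
  rewrite aut_morph altM aut_parity parity_refl -f2c_resE fE alt_f2c.
  under eq_bigr => i' _ do rewrite (Torelli_expsum i' (gen k) tT).
  rewrite -alt_f2c f2c_gen alt_reflM alt_refl.
  by move: (alt phi _) => s; clear; lia.
(* Rank at least two gives the three generators that exclude permutations. *)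
case: n n1 f fT {w tw fE} => [//|[//|m]] _ f fT.
have [r [rP fr]] := cox_torelli_pc_seq fT.
by rewrite fr in fT *; apply: cox_torelli_kernel.
Qed.

End Main.

Theorem theorem2 (n : nat) :
  ST n = generated [set outer tau | tau in doubled_commutator_transvection n].
Proof.
apply/seteqP; split=> u; first exact: ST_dct_generated.
apply: generated_ind; first exact: ST_subgroup.
by move=> _ [tau dtau <-]; apply: dct_ST.
Qed.
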